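(* Let $2<p<\infty$ and let $X$ be a subspace of some $L_p$ space, denoted $L_p$. The following are equivalent: (a) $\ell_p(\aleph_1)$ embeds isometrically into $X$. (b) There is a subspace of $X$ that is isomorphic to $\ell_p(\aleph_1)$ and is complemented in $L_p$. (c) $\ell_p(\aleph_1)$ embeds isomorphically into $X$. (d) There is no one-to-one bounded linear operator from $X$ into a Hilbert space.
   Context: An $L_p$ space is a Banach space $L_p(\nu)$ with $\nu$ an arbitrary (not necessarily finite or $\sigma$-finite) measure. Subspaces are closed linear subspaces; embeddings are linear. A subspace is complemented if it is the range of a bounded linear projection. The Hilbert space in (d) may be of arbitrary density character. For a cardinal $\aleph$, $\ell_p(\aleph)$ denotes $\ell_p(\Gamma)$ for a set $\Gamma$ of cardinality $\aleph$. *)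

(* Defs.v *)
From HB Require Import structures.
From mathcomp Require Import all_boot all_order all_algebra.
From mathcomp Require Import all_classical all_reals all_analysis.
From mathcomp Require Import measurable_realfun ess_sup_inf.

Set Implicit Arguments.
Unset Strict Implicit.
Unset Printing Implicit Defensive.

Import Order.TTheory GRing.Theory Num.Theory.
Import numFieldNormedType.Exports.

Local Open Scope classical_set_scope.
Local Open Scope ring_scope.

(* LspaceType mu p1 consists of classes of functions modulo mu-almost everywhere
   equality, but comes without any algebraic or normed structure. The operations
   below are computed on representatives: the coercion of x : LspaceType mu p1
   to a function picks one, so e.g. (x + y) t = x t + y t only holds for almost
   every t. *)
Section Lspace_normedModType.
Context {d : measure_display} {T : measurableType d} {R : realType}.
Variables (mu : {measure set T -> \bar R}) (p : \bar R) (p1 : (1 <= p)%E).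
Local Open Scope quotient_scope.
Local Notation Lf := (LfunType mu p1).
Local Notation Ls := (LspaceType mu p1).
Local Notation nm f := ('N[mu]_p[EFin \o f])%E.

Lemma ae_eq_Lnorm (f g : T -> R) :
  measurable_fun setT f -> measurable_fun setT g -> f = g %[ae mu] ->
  nm f = nm g.
Proof.
move=> mf mg fg; rewrite unlock /Lnorm; case: p p1 => [r _|_|//].
- have mpow (h : T -> R) : measurable_fun setT h ->
      measurable_fun setT (fun x => `|(EFin \o h) x| `^ r)%E.
    move=> mh; apply: (@measurableT_comp _ _ _ _ _ _ (fun y => y `^ r)%E).
      exact: measurable_poweR.
    by apply: measurableT_comp => //; exact/measurable_EFinP.
  congr (_ `^ _)%E; apply: ge0_ae_eq_integral => //.
  + exact: mpow.
  + exact: mpow.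
  + by move=> x _; exact: poweR_ge0.
  + by move=> x _; exact: poweR_ge0.
  + by apply: filterS fg => x /= + xT => /(_ xT) ->.
- case: ifPn => // _; apply: eq_ess_sup.
  by apply: filterS fg => x /= /(_ I) ->.
Qed.

Let mfun_of (f : Lf) : {mfun T >-> measurableTypeR R} :=
  MeasurableFun.Pack (MeasurableFun.Class
    (isMeasurableFun.Build _ _ T (measurableTypeR R) f (measurable_funPT f))).

Let mae (x : {mfun_ mu, T >-> measurableTypeR R}) :
  measurable_fun setT (x : T -> R).
Proof. exact: (measurable_funPT (repr x)). Qed.

Let aeclass (f : Lf) : {mfun_ mu, T >-> measurableTypeR R} :=
  \pi_({mfun_ mu, T >-> measurableTypeR R}) (mfun_of f).

Let aeclassE (f : Lf) : (aeclass f : T -> R) = f %[ae mu].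
Proof.
have /eqmodP/asboolP : repr (aeclass f) = mfun_of f
    %[mod {mfun_ mu, T >-> measurableTypeR R}] by rewrite reprK.
by [].
Qed.

Let aeclass_finite (f : Lf) : finite_norm mu p (aeclass f : T -> R).
Proof.
rewrite /finite_norm (@ae_eq_Lnorm _ f).
- exact: Lfunction_finite.
- exact: mae.
- exact: measurable_funPT.
- exact: aeclassE.
Qed.

Definition Lspace_class (f : Lf) : Ls :=
  LebesgueSpace.Pack (LebesgueSpace.Class
    (isFinLebesgue.Build _ T R mu p p1 (aeclass f) (aeclass_finite f))).

Let Lspace_Lfun (x : Ls) : (x : T -> R) \in Lfun mu p.
Proof. by apply/andP; split; rewrite inE//=; exact: Lebesgue_finite. Qed.

Definition Lspace_repr (x : Ls) : Lf := Lfun_Sub p1 (Lspace_Lfun x).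

Lemma Lspace_reprE (x : Ls) : Lspace_repr x = x :> (T -> R).
Proof. exact: Lfun_valP. Qed.

Lemma Lspace_classE (f : Lf) : (Lspace_class f : T -> R) = f %[ae mu].
Proof. exact: aeclassE. Qed.

Lemma Lspace_ext (x y : Ls) : (x : T -> R) = y %[ae mu] -> x = y.
Proof.
move=> xy.
have E : LebesgueSpace.sort x = LebesgueSpace.sort y.
  rewrite -[LHS]reprK -[RHS]reprK; apply/eqmodP; exact/asboolP.
case: x y E {xy} => [f [[Pf]]] [g [[Pg]]] /= E.
by subst g; rewrite (Prop_irrelevance Pf Pg).
Qed.

Lemma Lspace_classP (f g : Lf) :
  Lspace_class f = Lspace_class g <-> (f : T -> R) = g %[ae mu].
Proof.
split => [E|fg].
  apply: (ae_eq_trans (ae_eq_sym (Lspace_classE f))).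
  by rewrite E; exact: Lspace_classE.
apply: Lspace_ext; apply: (ae_eq_trans (Lspace_classE f)).
exact: (ae_eq_trans fg (ae_eq_sym (Lspace_classE g))).
Qed.

Lemma Lspace_reprK : cancel Lspace_repr Lspace_class.
Proof.
move=> x; apply: Lspace_ext; apply: (ae_eq_trans (Lspace_classE _)).
by rewrite Lspace_reprE; exact: ae_eq_refl.
Qed.

Lemma Lspace_classK (f : Lf) :
  (Lspace_repr (Lspace_class f) : T -> R) = f %[ae mu].
Proof. by rewrite Lspace_reprE; exact: Lspace_classE. Qed.

HB.instance Definition _ := gen_eqMixin Ls.
HB.instance Definition _ := gen_choiceMixin Ls.

Let add (x y : Ls) : Ls := Lspace_class (Lspace_repr x + Lspace_repr y).
Let opp (x : Ls) : Ls := Lspace_class (- Lspace_repr x).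
Let scale (a : R) (x : Ls) : Ls := Lspace_class (a *: Lspace_repr x).

Let add_class (f g : Lf) :
  add (Lspace_class f) (Lspace_class g) = Lspace_class (f + g).
Proof.
apply/Lspace_classP.
apply: filterS2 (Lspace_classK f) (Lspace_classK g) => x /(_ I) + /(_ I).
move=> fx gx _.
by rewrite -[RHS]/(f x + g x) -fx -gx.
Qed.

Let opp_class (f : Lf) : opp (Lspace_class f) = Lspace_class (- f).
Proof.
apply/Lspace_classP; apply: filterS (Lspace_classK f) => x /(_ I) fx _.
by rewrite -[RHS]/(- f x) -fx.
Qed.

Let scale_class a (f : Lf) :
  scale a (Lspace_class f) = Lspace_class (a *: f).
Proof.
apply/Lspace_classP; apply: filterS (Lspace_classK f) => x /(_ I) fx _.
by rewrite -[RHS]/(a * f x) -fx.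
Qed.

Let addA : associative add.
Proof.
move=> x y z; rewrite -(Lspace_reprK x) -(Lspace_reprK y) -(Lspace_reprK z).
by rewrite !add_class addrA.
Qed.

Let addC : commutative add.
Proof. by move=> x y; rewrite /add addrC. Qed.

Let add0 : left_id (Lspace_class 0) add.
Proof. by move=> x; rewrite -(Lspace_reprK x) add_class add0r. Qed.

Let addN : left_inverse (Lspace_class 0) opp add.
Proof. by move=> x; rewrite -(Lspace_reprK x) opp_class add_class addNr. Qed.

HB.instance Definition _ := GRing.isZmodule.Build Ls addA addC add0 addN.

Lemma Lspace_classD (f g : Lf) :
  Lspace_class (f + g) = Lspace_class f + Lspace_class g.
Proof. by rewrite -add_class. Qed.

Let scaleA a b x : scale a (scale b x) = scale (a * b) x.
Proof. by rewrite -(Lspace_reprK x) !scale_class scalerA. Qed.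

Let scale1 : left_id 1 scale.
Proof. by move=> x; rewrite -(Lspace_reprK x) scale_class scale1r. Qed.

Let scaleDr : right_distributive scale +%R.
Proof.
move=> a x y; rewrite -(Lspace_reprK x) -(Lspace_reprK y) -Lspace_classD !scale_class.
by rewrite -Lspace_classD scalerDr.
Qed.

Let scaleDl x : {morph scale^~ x : a b / a + b}.
Proof.
move=> a b; rewrite -(Lspace_reprK x) !scale_class -Lspace_classD.
by rewrite scalerDl.
Qed.

HB.instance Definition _ :=
  GRing.Zmodule_isLmodule.Build R Ls scaleA scale1 scaleDr scaleDl.

Lemma Lspace_classZ a (f : Lf) : Lspace_class (a *: f) = a *: Lspace_class f.
Proof. by rewrite -scale_class. Qed.

Let norm (x : Ls) : R := fine (nm x).

Let norm_class (f : Lf) : norm (Lspace_class f) = fine (nm f).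
Proof.
congr fine; apply: ae_eq_Lnorm; [exact: mae|exact: measurable_funPT|].
exact: Lspace_classE.
Qed.

Let ler_normD x y : norm (x + y) <= norm x + norm y.
Proof.
rewrite -(Lspace_reprK x) -(Lspace_reprK y) -Lspace_classD !norm_class.
exact: ler_LnormD.
Qed.

Let normZ a x : norm (a *: x) = `|a| * norm x.
Proof.
rewrite -(Lspace_reprK x) -Lspace_classZ !norm_class.
apply: EFin_inj; rewrite EFinM !finite_norm_fine -LnormZ.
by congr Lnorm.
Qed.

Let norm0_eq0 x : norm x = 0 -> x = 0.
Proof.
rewrite -(Lspace_reprK x) norm_class => /fine_Lnormr_eq0 x0.
exact/Lspace_classP.
Qed.

HB.instance Definition _ :=
  @Lmodule_isNormed.Build R Ls norm ler_normD normZ norm0_eq0.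

Lemma Lspace_normE (x : Ls) : `|x| = fine (nm x).
Proof. by []. Qed.

End Lspace_normedModType.

Definition discrete (G : Type) : Type := G.
HB.instance Definition _ (G : pointedType) := Pointed.on (discrete G).
HB.instance Definition _ (G : pointedType) :=
  @isMeasurable.Build default_measure_display (discrete G) discrete_measurable
    discrete_measurable0 discrete_measurableC discrete_measurableU.

(* [ell R G p1] is l_p(G), p1 : (1 <= p)%E: the L_p space of the counting
   measure on all subsets of G. *)
Notation ell R G p1 :=
  (LspaceType (@counting (discrete G) R : {measure set (discrete G) -> \bar R})
    p1).

(* aleph_1 is the least uncountable cardinal: G is uncountable and every
   smaller cardinal, i.e. that of any subset not equipotent to G, is
   countable. *)
Definition card_aleph1 (G : Type) : Prop :=
  ~ countable [set: G] /\ forall A : set G, countable A \/ (A #= [set: G])%card.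

Section subspaces_and_operators.
Context {R : realType}.
Implicit Types U V : normedModType R.

Definition closed_subspace V (X : set V) : Prop :=
  closed X /\ submod_closed (mem X).

Definition bounded_on (V W : normedModType R) (X : set V) (f : V -> W) : Prop :=
  exists C : R, forall x, X x -> `|f x| <= C * `|x|.

Definition complemented V (Y : set V) : Prop :=
  exists P : {linear V -> V},
    [/\ bounded_on setT P, forall x, P (P x) = P x & range P = Y].

(* The two-sided estimate says that the linear bijection f : U -> Y is bounded
   with bounded inverse. *)
Definition isomorphic_to U V (Y : set V) : Prop :=
  exists f : {linear U -> V},
    range f = Y /\
    exists c C : R, 0 < c /\ forall u, c * `|u| <= `|f u| <= C * `|u|.

Definition embeds_isomorphically U V (X : set V) : Prop :=
  exists Y : set V, [/\ closed_subspace Y, Y `<=` X & isomorphic_to U Y].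

Definition embeds_isometrically U V (X : set V) : Prop :=
  exists f : {linear U -> V}, range f `<=` X /\ forall u, `|f u| = `|u|.

Definition is_hilbert (H : completeNormedModType R) : Prop :=
  exists ip : {dot H for idfun}, forall x, `|x| ^+ 2 = ip x x.

(* The operator on X is represented by a function on V whose values outside X
   are irrelevant. *)
Definition injects_in_hilbert V (X : set V) : Prop :=
  exists H : completeNormedModType R, is_hilbert H /\
    exists S : V -> H,
      [/\ forall (a : R) x y, X x -> X y -> S (a *: x + y) = a *: S x + S y,
          bounded_on X S & set_inj X S].

End subspaces_and_operators.

Lemma gt2_ge1e {R : realType} {p : R} : 2 < p -> (1 <= p%:E)%E.
Proof. by move=> p2; rewrite lee_fin (le_trans _ (ltW p2))// ler1n. Qed.

(* Main.v *)
(* Call x and y disjoint if x * y = 0 almost everywhere. For p > 2 this means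
   |x + y|^p + |x - y|^p <= 2 |x|^p + 2 |y|^p (norms in L_p), so isometries
   preserve disjointness.

   (a) => (b): an isometry U maps the unit vectors e_g to disjoint u_g, and
   f |-> U (<f, u_g |u_g|^(p-2)>)_g is a bounded projection onto its range.
   (c) => (d): if S is one-to-one from l_p(aleph_1) to a Hilbert space, then
   |S e_g| >= delta for infinitely many g; with suitable signs, a sum of n of
   them has square norm at least n delta^2, against O(n^(2/p)).
   (d) => (a): take a maximal disjoint family in X, with indices in G. If its
   index set has cardinality aleph_1, it spans l_p(aleph_1) isometrically. If
   it is countable, some y in L_p has a support containing all of theirs, so
   no nonzero x in X is disjoint from y, and x |-> x |y|^((p-2)/2) is
   one-to-one and bounded from X to L_2. *)
From HB Require Import structures.
Require Import Defs.
From mathcomp Require Import all_boot all_order all_algebra.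
From mathcomp Require Import finmap.
From mathcomp Require Import all_classical all_reals all_analysis.
From mathcomp Require Import measurable_realfun.
From mathcomp Require Import ring lra.

Set Implicit Arguments.
Unset Strict Implicit.
Unset Printing Implicit Defensive.

Import Order.TTheory GRing.Theory Num.Theory.
Import numFieldNormedType.Exports.

Local Open Scope classical_set_scope.
Local Open Scope ring_scope.

(** * Inequalities for real powers, among them a Clarkson inequality for scalars *)

Section real_power_inequalities.
Context {R : realType}.
Implicit Types p s x y : R.

(** Split off one factor: (x + y)^s = x (x + y)^(s-1) + y (x + y)^(s-1), and t^(s-1) is strictly
    increasing because s > 1. *)
Lemma lt_powRD s x y : 1 < s -> 0 < x -> 0 < y ->
  x `^ s + y `^ s < (x + y) `^ s.
Proof.
move=> s1 x0 y0; have s0 : 0 < s by exact: lt_trans s1.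
have xy0 : 0 < x + y by exact: addr_gt0.
rewrite -!(@mulr_powRB1 _ _ s) ?ltW// mulrDl.
by apply: ltrD; rewrite ltr_pM2l// gt0_ltr_powR ?subr_gt0 ?nnegrE ?ltW//;
  rewrite ?ltrDl ?ltrDr.
Qed.

Lemma le_powRD s x y : 1 < s -> 0 <= x -> 0 <= y ->
  x `^ s + y `^ s <= (x + y) `^ s.
Proof.
move=> s1; have s0 : s != 0 by rewrite gt_eqF// (lt_trans _ s1).
rewrite le_eqVlt => /predU1P[<- _|x0]; first by rewrite powR0// !add0r.
rewrite le_eqVlt => /predU1P[<-|y0]; first by rewrite powR0// !addr0.
exact/ltW/lt_powRD.
Qed.

Lemma midpoint_powR s x y : 1 <= s -> 0 <= x -> 0 <= y ->
  2 * ((x + y) / 2) `^ s <= x `^ s + y `^ s.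
Proof.
move=> s1 x0 y0.
have h : (2^-1 * x + 2^-1 * y) `^ s <= 2^-1 * x `^ s + 2^-1 * y `^ s.
  (* Convexity is stated with weights t and 1 - t, so the two weights that belong to [y] are put in
     the second form. *)
  rewrite {2 4}(_ : 2^-1 = 1 - 2^-1); last by rewrite {2}(splitr 1) div1r addrK.
  apply: (convex_powR s1 (Itv01 _ _)) => //=;
    by rewrite ?inE/= ?in_itv/= ?x0 ?y0 ?invr_ge0// ?invf_le1 ?ler1n.
move: h; rewrite -mulrDr mulrC => h.
rewrite -mulrDr in h.
by rewrite mulrC -ler_pdivlMr// [leRHS]mulrC.
Qed.

Lemma normr_powR_sqr p x : `|x| `^ p = (x ^+ 2) `^ (p / 2).
Proof.
rewrite -[x ^+ 2]real_normK ?num_real// -powR_mulrn// -powRrM.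
by rewrite mulrC divfK.
Qed.

(* Midpoint convexity of [t `^ (p / 2)] at the squares of [x + y] and [x - y],
   whose mean is [x ^+ 2 + y ^+ 2], followed by superadditivity. *)
Lemma clarkson_powR p x y : 2 < p ->
  2 * `|x| `^ p + 2 * `|y| `^ p <= `|x + y| `^ p + `|x - y| `^ p.
Proof.
move=> p2; have s1 : 1 < p / 2 by rewrite ltr_pdivlMr ?mul1r.
rewrite !(normr_powR_sqr p) -mulrDr.
have := midpoint_powR (ltW s1) (sqr_ge0 (x + y)) (sqr_ge0 (x - y)).
rewrite (_ : _ / 2 = x ^+ 2 + y ^+ 2); last by field.
by apply: le_trans; rewrite ler_pM2l// le_powRD ?sqr_ge0.
Qed.

(** Same argument as for [clarkson_powR]; now both squares are positive, so superadditivity is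
    strict. This is what later forces disjointness from an inequality between norms. *)
Lemma clarkson_powR_lt p x y : 2 < p -> x * y != 0 ->
  2 * `|x| `^ p + 2 * `|y| `^ p < `|x + y| `^ p + `|x - y| `^ p.
Proof.
move=> p2; rewrite mulf_eq0 negb_or => /andP[x0 y0].
have s1 : 1 < p / 2 by rewrite ltr_pdivlMr ?mul1r.
rewrite !(normr_powR_sqr p) -mulrDr.
have := midpoint_powR (ltW s1) (sqr_ge0 (x + y)) (sqr_ge0 (x - y)).
rewrite (_ : _ / 2 = x ^+ 2 + y ^+ 2); last by field.
by apply: lt_le_trans; rewrite ltr_pM2l// lt_powRD// exprn_even_gt0.
Qed.

(* The first term bounds the left-hand side when [ `|x| <= `|y| / 2], the second
   one when [ `|y| < 2 * `|x|]. *)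
Lemma mul_powRB1_le p x y : 1 <= p ->
  `|x| * `|y| `^ (p - 1) <= `|y| `^ p / 2 + 2 `^ p * `|x| `^ p.
Proof.
move=> p1; have p0 : 0 < p by exact: lt_le_trans p1.
have [xy|xy] := leP (`|x|) (`|y| / 2).
  rewrite (@le_trans _ _ (`|y| `^ p / 2))//; last first.
    by rewrite lerDl mulr_ge0// powR_ge0.
  by rewrite -(@mulr_powRB1 _ `|y| p)// mulrAC ler_wpM2r// powR_ge0.
rewrite (@le_trans _ _ (2 `^ p * `|x| `^ p))//; last first.
  by rewrite lerDr divr_ge0// powR_ge0.
rewrite -powRM// -(@mulr_powRB1 _ (2 * `|x|) p) ?mulr_ge0//.
rewrite ler_pM ?powR_ge0// ?ler_peMl ?ler1n//.
rewrite ge0_ler_powR ?subr_ge0 ?nnegrE ?mulr_ge0// ltW//.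
by move: xy; rewrite ltr_pdivrMr// mulrC.
Qed.

(** Replace the smaller of |x| and |y| by the larger one. The exponents (1, p - 1) serve the duality
    pairing, and (2, p - 2) the weighted map to L_2. *)
Lemma mul_powR_le s t x y : 0 <= s -> 0 <= t -> 0 < s + t ->
  `|x| `^ s * `|y| `^ t <= `|x| `^ (s + t) + `|y| `^ (s + t).
Proof.
move=> s0 t0 st; have D (z : R) : `|z| `^ s * `|z| `^ t = `|z| `^ (s + t).
  by rewrite powRD// (gt_eqF st).
have [xy|/ltW xy] := leP `|x| `|y|.
  rewrite (@le_trans _ _ (`|y| `^ (s + t))) ?lerDr ?powR_ge0// -D.
  by rewrite ler_wpM2r ?powR_ge0// ge0_ler_powR// nnegrE.
rewrite (@le_trans _ _ (`|x| `^ (s + t))) ?lerDl ?powR_ge0// -D.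
by rewrite ler_wpM2l ?powR_ge0// ge0_ler_powR// nnegrE.
Qed.

End real_power_inequalities.

(** * Sequences with geometrically decreasing increments *)

Section geometric_sequences.
Context {R : realType} {V : normedModType R}.

Lemma geometric_dist (u : nat -> V) (C : R) : 0 <= C ->
  (forall n, `|u n.+1 - u n| <= C * 2^-1 ^+ n) ->
  forall m n, (n <= m)%N -> `|u m - u n| <= 2 * C * 2^-1 ^+ n.
Proof.
move=> C0 uC m n /subnKC <-; set k := (m - n)%N.
(* The exact partial geometric sum, with its factor 1 - 2^-k, is what passes through the induction
   on [k]. *)
suff : `|u (n + k)%N - u n| <= 2 * C * 2^-1 ^+ n * (1 - 2^-1 ^+ k).
  move=> /le_trans; apply; apply: ler_piMr.
    by rewrite !mulr_ge0// exprn_ge0// invr_ge0.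
  by rewrite lerBlDr lerDl exprn_ge0// invr_ge0.
elim: k => [|k IH]; first by rewrite addn0 !subrr normr0 mulr0.
rewrite addnS -(subrKA (u (n + k)%N)).
apply: (le_trans (ler_normD _ _)).
apply: (le_trans (lerD (uC _) IH)).
rewrite exprD exprS; set a := _ ^+ n; set b := _ ^+ k.
by rewrite le_eqVlt; apply/orP; left; apply/eqP; field.
Qed.

Lemma geometric_cvg (u : nat -> V) (C : R) : 0 <= C ->
  (forall m n, (n <= m)%N -> `|u m - u n| <= C * 2^-1 ^+ n) ->
  cauchy (u @ \oo).
Proof.
move=> C0 uC; apply/cauchy_exP => e e0.
have : C * 2^-1 ^+ n @[n --> \oo] --> C * 0.
  apply: cvgM; first exact: cvg_cst.
  by apply: cvg_expr; rewrite ger0_norm// invf_lt1// ltr1n.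
rewrite mulr0 => /cvgr0Pnorm_lt /(_ _ e0) [N _ HN].
exists (u N); exists N => // m /= Nm.
rewrite -ball_normE/= distrC; apply: le_lt_trans (uC _ _ Nm) _.
have := HN N (leqnn N).
by rewrite ger0_norm// mulr_ge0// exprn_ge0// invr_ge0.
Qed.

End geometric_sequences.

(** * Almost everywhere description of the operations and the norm of L_p *)

Section Lspace_theory.
Context {d : measure_display} {T : measurableType d} {R : realType}.
Variables (mu : {measure set T -> \bar R}) (p : R) (p1 : (1 <= p%:E)%E).
Local Notation L := (LspaceType mu p1).
Implicit Types x y z u v : L.

Let p_ge1 : 1 <= p. Proof. by move: p1; rewrite lee_fin. Qed.
Let p_gt0 : 0 < p. Proof. exact: lt_le_trans p_ge1. Qed.
Let p_neq0 : p != 0. Proof. by rewrite gt_eqF. Qed.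

Lemma measurable_normr_powR (f : T -> R) q :
  measurable_fun setT f -> measurable_fun setT (fun t => `|f t| `^ q).
Proof.
move=> mf; apply: (@measurableT_comp _ _ _ _ _ _ (@powR R ^~ q)) => //.
exact: measurableT_comp.
Qed.

Lemma emeasurable_normr_powR (f : T -> R) q :
  measurable_fun setT f -> measurable_fun setT (fun t => (`|f t| `^ q)%:E).
Proof. by move=> mf; exact/measurable_EFinP/measurable_normr_powR. Qed.

Lemma measurable_Lspace x : measurable_fun setT (x : T -> R).
Proof. exact: (measurable_funPT (Lspace_repr x)). Qed.

Lemma LspaceP x y : x = y <-> \forall t \ae mu, x t = y t.
Proof.
split=> [->|xy]; first exact: nearW.
by apply: Lspace_ext; apply: filterS xy => t.
Qed.

Lemma LspaceD x y : \forall t \ae mu, (x + y) t = x t + y t.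
Proof.
have := Lspace_classE (Lspace_repr x + Lspace_repr y).
by rewrite Lspace_classD !Lspace_reprK; apply: filterS => t /(_ I) ->.
Qed.

Lemma LspaceZ a x : \forall t \ae mu, (a *: x) t = a * x t.
Proof.
have := Lspace_classE (a *: Lspace_repr x).
by rewrite Lspace_classZ !Lspace_reprK; apply: filterS => t /(_ I) ->.
Qed.

Lemma Lspace0 : \forall t \ae mu, (0 : L) t = 0.
Proof.
have := LspaceZ 0 (0 : L).
by rewrite scale0r; apply: filterS => t ->; rewrite mul0r.
Qed.

Lemma LspaceN x : \forall t \ae mu, (- x) t = - x t.
Proof.
have := LspaceZ (-1) x.
by rewrite scaleN1r; apply: filterS => t ->; rewrite mulN1r.
Qed.

Lemma LspaceB x y : \forall t \ae mu, (x - y) t = x t - y t.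
Proof. by near=> t; rewrite (near (LspaceD x (- y)) t)// (near (LspaceN y) t).
Unshelve. all: by end_near. Qed.

Lemma integral_Lspace x : (\int[mu]_t (`|x t| `^ p)%:E = (`|x| `^ p)%:E)%E.
Proof.
have E : (`|x|)%:E = 'N[mu]_p%:E[EFin \o x]%E.
  by rewrite Lspace_normE -[in LHS](Lspace_reprE x) finite_norm_fine.
by rewrite -poweR_EFin E powR_Lnorm.
Qed.

Lemma Lspace_of_fun (f : T -> R) : measurable_fun setT f ->
  (\int[mu]_t (`|f t| `^ p)%:E < +oo)%E ->
  exists x, \forall t \ae mu, x t = f t.
Proof.
move=> mf foo; have fL : f \in Lfun mu p%:E.
  rewrite inE; apply/andP; split; rewrite inE//=.
  by rewrite /finite_norm unlock poweR_lty.
exists (Lspace_class (Lfun_Sub p1 fL)).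
by apply: filterS (Lspace_classE (Lfun_Sub p1 fL)) => t /(_ I) ->.
Qed.

Lemma Lspace_norm_ae (f : T -> R) x : measurable_fun setT f ->
  (\forall t \ae mu, x t = f t) ->
  (\int[mu]_t (`|f t| `^ p)%:E = (`|x| `^ p)%:E)%E.
Proof.
move=> mf xf; rewrite -integral_Lspace; apply: ge0_ae_eq_integral => //.
- exact: emeasurable_normr_powR.
- exact/emeasurable_normr_powR/measurable_Lspace.
- by apply: filterS xf => t ->.
Qed.

(** The majorant is extended-real because the completeness proof applies this to multiples of a
    series that may diverge on a null set. *)
Lemma Lspace_norm_le (f : T -> \bar R) x (M : R) : 0 <= M ->
  measurable_fun setT f -> (forall t, 0 <= f t)%E ->
  (\forall t \ae mu, ((`|x t| `^ p)%:E <= f t)%E) ->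
  (\int[mu]_t f t <= (M `^ p)%:E)%E -> `|x| <= M.
Proof.
move=> M0 mf f0 xf fM.
suff : `|x| `^ p <= M `^ p.
  by apply: contraTT; rewrite -!ltNge => Mx; rewrite gt0_ltr_powR ?nnegrE.
rewrite -lee_fin -integral_Lspace; apply: le_trans fM.
apply: ae_ge0_le_integral => //.
- exact/emeasurable_normr_powR/measurable_Lspace.
- by apply: filterS xf.
Qed.

Lemma integrable_Lspace x : mu.-integrable setT (fun t => (`|x t| `^ p)%:E).
Proof.
apply/integrableP; split.
  exact/emeasurable_normr_powR/measurable_Lspace.
under eq_integral do rewrite gee0_abs ?lee_fin ?powR_ge0//.
by rewrite integral_Lspace ltry.
Qed.

End Lspace_theory.

(** * Completeness of L_p *)

Section completeness.
Context {d : measure_display} {T : measurableType d} {R : realType}.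
Variables (mu : {measure set T -> \bar R}) (p : R) (p1 : (1 <= p%:E)%E).
Local Notation L := (LspaceType mu p1).

Let p_ge1 : 1 <= p. Proof. by move: p1; rewrite lee_fin. Qed.
Let p_gt0 : 0 < p. Proof. exact: lt_le_trans p_ge1. Qed.
Let p_neq0 : p != 0. Proof. by rewrite gt_eqF. Qed.

(* With [s t] the l_p norm of the sequence [2 ^+ n * (x n.+1 t - x n t)], the
   increments at [t] are at most [s t / 2 ^+ n], and [s `^ p] is integrable by
   monotone convergence: this gives both the pointwise limit and the bound on
   the norm of the remainders. *)
Lemma Lspace_geometric_limit (x : nat -> L) :
  (forall n, `|x n.+1 - x n| <= 4^-1 ^+ n) ->
  exists l, forall n, `|l - x n| <= 4 * 2^-1 ^+ n.
Proof.
move=> xn.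
pose y n t := 2 ^+ n * (x n.+1 t - x n t).
have my n : measurable_fun setT (y n).
  apply: measurable_funM => //.
  by apply: measurable_funB; exact: measurable_Lspace.
have mp n := emeasurable_normr_powR p (my n).
have yp0 n t : (0 <= (`|y n t| `^ p)%:E)%E by rewrite lee_fin powR_ge0.
have inty n : (\int[mu]_t (`|y n t| `^ p)%:E <= (2^-1 ^+ n)%:E)%E.
  rewrite (@Lspace_norm_ae _ _ _ _ _ p1 _ (2 ^+ n *: (x n.+1 - x n)))//;
    last first.
    by near=> t; rewrite (near (LspaceZ _ _) t)// (near (LspaceB _ _) t).
  rewrite lee_fin normrZ ger0_norm ?exprn_ge0//.
  have h : 2 ^+ n * `|x n.+1 - x n| <= 2^-1 ^+ n.
    apply: (@le_trans _ _ (2 ^+ n * 4^-1 ^+ n)).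
      by rewrite ler_wpM2l// exprn_ge0.
    by rewrite -exprMn (_ : 2 * 4^-1 = 2^-1 :> R)//; field.
  have h2 : 0 < (2^-1 : R) ^+ n <= 1.
    apply/andP; split; first by rewrite exprn_gt0// invr_gt0.
    by apply: exprn_ile1; rewrite ?invr_ge0// invf_le1 ?ler1n.
  apply: le_trans (ge1r_powR h2 p_ge1).
  by apply: ge0_ler_powR;
    rewrite ?nnegrE ?(ltW p_gt0)// ?mulr_ge0// ?exprn_ge0// invr_ge0.
pose S t := (\sum_(0 <= n <oo) (`|y n t| `^ p)%:E)%E.
have S0 t : (0 <= S t)%E by exact: nneseries_ge0.
have mS : measurable_fun setT S by exact: ge0_emeasurable_sum.
have intS : (\int[mu]_t S t <= 2%:E)%E.
  rewrite integral_nneseries//.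
  apply: lime_le.
    by apply: is_cvg_nneseries => n _ _; exact: integral_ge0.
  apply: nearW => n.
  apply: (@le_trans _ _ (\sum_(0 <= i < n) (2^-1 ^+ i)%:E)%E).
    exact: lee_sum.
  rewrite sumEFin lee_fin (_ : \sum_(_ <= _ < _) _ = 2 - 2 * 2^-1 ^+ n).
    by rewrite gerBl mulr_ge0// exprn_ge0// invr_ge0.
  elim: n => [|n IH]; first by rewrite big_geq// expr0 mulr1 subrr.
  by rewrite big_nat_recr//= IH exprS; field.
have iS : mu.-integrable setT S.
  apply/integrableP; split => //.
  under eq_integral do rewrite gee0_abs//.
  exact: le_lt_trans intS (ltry _).
have aeS : \forall t \ae mu, S t \is a fin_num.
  by apply: filterS (integrable_ae measurableT iS) => t; exact.
pose s t := fine (S t) `^ p^-1.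
have s0 t : 0 <= s t by exact: powR_ge0.
have sp t : S t \is a fin_num -> S t = (s t `^ p)%:E.
  move=> St; rewrite /s -powRrM mulVf// powRr1 ?fineK//.
  exact: fine_ge0.
have ys t k : S t \is a fin_num -> `|x k.+1 t - x k t| <= s t * 2^-1 ^+ k.
  move=> St; have : `|y k t| `^ p <= s t `^ p.
    rewrite -lee_fin -sp//.
    apply: le_trans (nneseries_lim_ge (m := 0) k.+1 _); last by [].
    by rewrite big_nat_recr//= leeDr// sume_ge0.
  move=> h; have {}h : `|y k t| <= s t.
    move: h; apply: contraTT; rewrite -!ltNge => h.
    by rewrite gt0_ltr_powR ?nnegrE.
  move: h; rewrite /y normrM ger0_norm ?exprn_ge0// mulrC => h.
  by rewrite exprVn ler_pdivlMr// exprn_gt0.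
have xs t m n : S t \is a fin_num -> (n <= m)%N ->
    `|x m t - x n t| <= 2 * s t * 2^-1 ^+ n.
  move=> St; apply: (@geometric_dist R R^o (fun n => x n t)) => // k.
  exact: ys.
pose E := [set t | S t \is a fin_num].
have mE : measurable E.
  by have := emeasurable_fin_num measurableT mS; rewrite setTI.
(* The indicator of [E] makes the sequence converge at every point, to 0 off [E], so that its limit
   is measurable. *)
pose l0 t := limn (fun n => x n t * \1_E t).
have cl0 t : x n t * \1_E t @[n --> \oo] --> l0 t.
  have [Et|nEt] := pselect (E t); last first.
    rewrite /l0 indicE memNset//; under eq_fun do rewrite mulr0.
    by rewrite lim_cst//; exact: cvg_cst.
  have : cvgn (fun n => x n t * \1_E t); last by [].
  apply: cauchy_cvg; rewrite indicE mem_set//; under eq_fun do rewrite mulr1.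
  apply: (@geometric_cvg R R^o _ (2 * s t)); first by rewrite mulr_ge0.
  by move=> m n; exact: xs.
have ml0 : measurable_fun setT l0.
  apply: (@measurable_fun_cvg _ _ _ _ (fun n t => x n t * \1_E t)) => [n|t _].
    apply: measurable_funM; first exact: measurable_Lspace.
    exact: measurable_indic.
  exact: cl0.
have l0x t n : E t -> `|l0 t - x n t| <= 2 * s t * 2^-1 ^+ n.
  move=> Et; have : `|x m t - x n t| @[m --> \oo] --> `|l0 t - x n t|.
    apply: cvg_norm; apply: cvgB; last exact: cvg_cst.
    have := cl0 t; rewrite indicE mem_set//; under eq_fun do rewrite mulr1.
    exact.
  by move/cvgr_to_le; apply; exists n => // m /= nm; exact: xs.
have Smaj n t : E t ->
    ((`|l0 t - x n t| `^ p)%:E <= ((2 * 2^-1 ^+ n) `^ p)%:E * S t)%E.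
  move=> Et; rewrite sp// -EFinM lee_fin.
  rewrite -powRM ?mulr_ge0 ?exprn_ge0 ?invr_ge0//; apply: ge0_ler_powR;
    rewrite ?nnegrE ?(ltW p_gt0) ?mulr_ge0 ?exprn_ge0 ?invr_ge0//.
  by rewrite mulrAC l0x.
(* The integral of [S] is at most 2, and 2 <= 2^p moves this factor inside the power; this is how
   the constant 4 arises. *)
have intM n : (\int[mu]_t (((2 * 2^-1 ^+ n) `^ p)%:E * S t) <=
    ((4 * 2^-1 ^+ n) `^ p)%:E)%E.
  rewrite ge0_integralZl_EFin ?powR_ge0//.
  apply: (@le_trans _ _ (((2 * 2^-1 ^+ n) `^ p)%:E * 2%:E)%E).
    by rewrite lee_wpmul2l// lee_fin powR_ge0.
  rewrite -EFinM lee_fin (_ : 4 = 2 * 2); last by rewrite -natrM.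
  rewrite -mulrA [in leRHS]powRM ?mulr_ge0 ?exprn_ge0 ?invr_ge0// mulrC.
  by rewrite ler_wpM2r ?powR_ge0// le1r_powR ?ler1n.
have mSn n : measurable_fun setT (fun t => ((2 * 2^-1 ^+ n) `^ p)%:E * S t)%E.
  exact: emeasurable_funM.
have mlx n : measurable_fun setT (fun t => l0 t - x n t).
  by apply: measurable_funB => //; exact: measurable_Lspace.
(* The estimate for n = 0 shows that the p-th power of |l0 - x 0| is integrable; the limit is then
   the class of this difference plus [x 0]. *)
have [|z zE] := @Lspace_of_fun _ _ _ mu p p1 _ (mlx 0).
  apply: le_lt_trans (ltry ((4 * 2^-1 ^+ 0) `^ p)).
  apply: le_trans (intM 0); apply: ae_ge0_le_integral => //.
  - exact: emeasurable_normr_powR.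
  - by move=> t _; rewrite mule_ge0// lee_fin powR_ge0.
  - by apply: filterS aeS => t Et _; exact: Smaj.
exists (z + x 0) => n.
have M0 : 0 <= 4 * 2^-1 ^+ n :> R by rewrite mulr_ge0// exprn_ge0// invr_ge0.
apply: (Lspace_norm_le M0 (mSn n)) => //.
- by move=> t; rewrite mule_ge0// lee_fin powR_ge0.
- near=> t; have Et : E t by near: t.
  rewrite (near (LspaceB _ _) t)// (near (LspaceD _ _) t)// (near zE t)//.
  by rewrite subrK Smaj.
Unshelve. all: by end_near.
Qed.

Lemma Lspace_complete (F : set_system L) : ProperFilter F -> cauchy F -> cvg F.
Proof.
move=> FF /cauchyP cF.
(* Balls from a proper filter meet, so consecutive centres are closer than [e n + e n.+1], which is
   below the rate 4^-n that [Lspace_geometric_limit] asks for. *)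
pose e n : R := 8^-1 * 4^-1 ^+ n.
have e0 n : 0 < e n by rewrite mulr_gt0 ?invr_gt0// exprn_gt0// invr_gt0.
have /choice[x Fx] : forall n, exists x, F (ball x (e n)).
  by move=> n; exact: cF.
have [|l xl] := @Lspace_geometric_limit x.
  move=> n; have [y [/= ]] := filter_ex (filterI (Fx n) (Fx n.+1)).
  rewrite -!ball_normE/= => h1 h2.
  rewrite distrC -(subrKA y); apply: (le_trans (ler_normD _ _)).
  rewrite [ `|y - _|]distrC; apply: (le_trans (lerD (ltW h1) (ltW h2))).
  have : 0 <= 4^-1 ^+ n :> R by rewrite exprn_ge0// invr_ge0.
  rewrite /e exprS; lra.
apply/cvg_ex; exists l; apply/fcvg_ballP => r r0.
(* 5 = 4 + 1: the limit is within 4 / 2^n of [x n], and the radius [e n] is at most 1 / 2^n. *)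
have : 5 * 2^-1 ^+ n @[n --> \oo] --> (5 * 0 : R).
  apply: cvgM; first exact: cvg_cst.
  by apply: cvg_expr; rewrite ger0_norm ?invr_ge0// invf_lt1// ltr1n.
rewrite mulr0 => /cvgr0Pnorm_lt /(_ _ r0) [n _ /(_ n (leqnn n))].
rewrite ger0_norm ?mulr_ge0 ?exprn_ge0 ?invr_ge0// => nr.
apply: filterS (Fx n) => y; rewrite -!ball_normE/= => h.
rewrite -(subrKA (x n)); apply: le_lt_trans (ler_normD _ _) _.
apply: le_lt_trans nr.
apply: (@le_trans _ _ (4 * 2^-1 ^+ n + 2^-1 ^+ n)); last by lra.
apply: lerD => //; apply: (le_trans (ltW h)); rewrite /e.
have h1 : 4^-1 ^+ n <= 2^-1 ^+ n :> R.
  by rewrite lerXn2r ?nnegrE ?invr_ge0// lef_pV2 ?posrE// ler_nat.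
have : 0 <= 4^-1 ^+ n :> R by rewrite exprn_ge0// invr_ge0.
lra.
Qed.

HB.instance Definition _ := Uniform_isComplete.Build L Lspace_complete.

End completeness.


(** * Disjointness and its characterization by norms *)

Section disjoint_supports.
Context {d : measure_display} {T : measurableType d} {R : realType}.
Variables (mu : {measure set T -> \bar R}) (p : R) (p1 : (1 <= p%:E)%E).
Local Notation L := (LspaceType mu p1).
Implicit Types x y z u v : L.

Let p_ge1 : 1 <= p. Proof. by move: p1; rewrite lee_fin. Qed.
Let p_gt0 : 0 < p. Proof. exact: lt_le_trans p_ge1. Qed.
Let p_neq0 : p != 0. Proof. by rewrite gt_eqF. Qed.

Definition ae_disjoint x y := \forall t \ae mu, x t * y t = 0.

Lemma ae_disjointC x y : ae_disjoint x y -> ae_disjoint y x.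
Proof. by apply: filterS => t; rewrite mulrC. Qed.

Lemma ae_disjoint0 x : ae_disjoint 0 x.
Proof. by apply: filterS (Lspace0 mu p1) => t ->; rewrite mul0r. Qed.

Lemma ae_disjointD x y z :
  ae_disjoint x z -> ae_disjoint y z -> ae_disjoint (x + y) z.
Proof.
move=> xz yz; near=> t; rewrite (near (LspaceD x y) t)// mulrDl.
by rewrite (near xz t)// (near yz t)// addr0.
Unshelve. all: by end_near. Qed.

Lemma ae_disjointZ a x z : ae_disjoint x z -> ae_disjoint (a *: x) z.
Proof.
move=> xz; near=> t; rewrite (near (LspaceZ a x) t)// -mulrA.
by rewrite (near xz t)// mulr0.
Unshelve. all: by end_near. Qed.

Lemma ae_disjoint_sum (I : Type) (r : seq I) (P : pred I) (x : I -> L) z :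
  (forall i, P i -> ae_disjoint (x i) z) ->
  ae_disjoint (\sum_(i <- r | P i) x i) z.
Proof.
move=> xz; apply: (big_ind (fun x => ae_disjoint x z)) => //.
- exact: ae_disjoint0.
- by move=> ? ?; exact: ae_disjointD.
Qed.

Lemma ae_disjoint_normD x y : ae_disjoint x y ->
  `|x + y| `^ p = `|x| `^ p + `|y| `^ p.
Proof.
move=> xy; apply: EFin_inj; rewrite EFinD -!integral_Lspace.
have m z := emeasurable_normr_powR p (measurable_Lspace z).
rewrite -ge0_integralD//.
apply: ge0_ae_eq_integral => //.
- exact: emeasurable_funD.
- by move=> t _; rewrite adde_ge0// lee_fin powR_ge0.
- near=> t => _; rewrite (near (LspaceD x y) t)// -EFinD; congr EFin.
  have /eqP : x t * y t = 0 by near: t.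
  rewrite mulf_eq0 => /orP[]/eqP ->; rewrite normr0 powR0//.
    by rewrite !add0r.
  by rewrite !addr0.
Unshelve. all: by end_near. Qed.

(** By [clarkson_powR] the difference [A t - B t] is nonnegative. The inequality between norms makes
    its integral 0, hence it vanishes almost everywhere, which [clarkson_powR_lt] excludes wherever
    x t * y t is nonzero. *)
Lemma ae_disjointP x y : 2 < p ->
  ae_disjoint x y <->
  `|x + y| `^ p + `|x - y| `^ p <= 2 * `|x| `^ p + 2 * `|y| `^ p.
Proof.
move=> p2; split=> [xy|].
  rewrite !ae_disjoint_normD//; last first.
    by rewrite -scaleN1r; exact/ae_disjointC/ae_disjointZ/ae_disjointC.
  by rewrite normrN addrACA -!mulr2n !mulr_natl.
pose A t := `|x t + y t| `^ p + `|x t - y t| `^ p.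
pose B t := 2 * `|x t| `^ p + 2 * `|y t| `^ p.
have AB t : 0 <= A t - B t by rewrite subr_ge0 clarkson_powR.
have B0 t : 0 <= B t by rewrite addr_ge0// mulr_ge0// powR_ge0.
have mx := measurable_Lspace x; have my := measurable_Lspace y.
have mD : measurable_fun setT (fun t => x t + y t) by exact: measurable_funD.
have mB : measurable_fun setT (fun t => x t - y t) by exact: measurable_funB.
have mA : measurable_fun setT A.
  by apply: measurable_funD; exact: measurable_normr_powR.
have mB' : measurable_fun setT B.
  by apply: measurable_funD; apply: measurable_funM => //;
    exact: measurable_normr_powR.
have iA : (\int[mu]_t (A t)%:E = (`|x + y| `^ p + `|x - y| `^ p)%:E)%E.
  under eq_integral do rewrite /A EFinD.
  rewrite ge0_integralD//; [|exact: emeasurable_normr_powR..].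
  rewrite (Lspace_norm_ae mD (LspaceD x y)).
  by rewrite (Lspace_norm_ae mB (LspaceB x y)).
have iB : (\int[mu]_t (B t)%:E = (2 * `|x| `^ p + 2 * `|y| `^ p)%:E)%E.
  have m2 z : measurable_fun setT (fun t => (2%:E * (`|z t| `^ p)%:E)%E).
    exact/emeasurable_funM/emeasurable_normr_powR/measurable_Lspace.
  under eq_integral do rewrite /B EFinD !EFinM.
  rewrite ge0_integralD//.
  rewrite !ge0_integralZl_EFin//; first by rewrite !integral_Lspace.
  - exact/emeasurable_normr_powR.
  - exact/emeasurable_normr_powR.
rewrite -lee_fin -iA -iB => iAB.
have mAB : measurable_fun setT (fun t => (A t - B t)%:E).
  by apply/measurable_EFinP; exact: measurable_funB.
have : (\int[mu]_t (A t)%:E =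
    \int[mu]_t (B t)%:E + \int[mu]_t (A t - B t)%:E)%E.
  have mBE := (measurable_EFinP _ _).2 mB'.
  rewrite -ge0_integralD//; [|by move=> t _; rewrite lee_fin..].
  by apply: eq_integral => t _; rewrite -EFinD subrKC.
move=> iABE; have {iABE iAB} : (\int[mu]_t (A t - B t)%:E = 0)%E.
  apply/eqP; rewrite eq_le integral_ge0 ?andbT//; last first.
    by move=> t _; rewrite lee_fin.
  (* The integral of [B] is finite by [iB], so it can be cancelled. *)
  by move: iAB; rewrite iABE -[leRHS]adde0 leeD2lE// iB.
move=> h; have {}h : (\int[mu]_t `|(A t - B t)%:E| = 0)%E.
  by rewrite -[RHS]h; apply: eq_integral => t _; rewrite gee0_abs// lee_fin.
have /(ae_eq_integral_abs mu measurableT mAB) := h.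
apply: filterS => t /(_ I)[/eqP]; rewrite subr_eq0 => /eqP ABt.
apply/eqP; apply: contraT => /(clarkson_powR_lt p2).
by rewrite -/(A t) -/(B t) ABt ltxx.
Qed.

(** Restriction to the support of [z] annihilates every [w] disjoint from [z]. So the restriction
    [v] of [u] has norm at most |u - w|, which is arbitrarily small. *)
Lemma ae_disjoint_approx u z :
  (forall e, 0 < e -> exists2 w, ae_disjoint w z & `|u - w| <= e) ->
  ae_disjoint u z.
Proof.
move=> H; pose E := [set t | z t != 0].
have mE : d.-measurable E.
  rewrite [E](_ : _ = setT `&` z @^-1` (~` [set 0])).
    apply: measurable_Lspace => //; exact: measurableC.
  by rewrite setTI; apply/seteqP; split => t /= /eqP.
have mf : measurable_fun setT (fun t => u t * \1_E t).
  apply: measurable_funM; first exact: measurable_Lspace.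
  exact: measurable_indic.
have uE t : `|u t * \1_E t| <= `|u t|.
  by rewrite normrM ler_piMr// indicE; case: (_ \in _); rewrite ?normr1 ?normr0.
have [|v vE] := @Lspace_of_fun _ _ _ mu p p1 _ mf.
  apply: le_lt_trans (ltry (`|u| `^ p)); rewrite -integral_Lspace.
  apply: ge0_le_integral => //.
  - exact: emeasurable_normr_powR.
  - exact/emeasurable_normr_powR/measurable_Lspace.
  - by move=> t _; rewrite lee_fin ge0_ler_powR ?nnegrE// ltW.
have v0 : v = 0.
  apply/eqP; rewrite -normr_le0 leNgt; apply/negP => v0.
  have h : 0 < `|v| / 2 by rewrite divr_gt0//.
  have [w wz uw] := H _ h.
  have : `|v| <= `|u - w|.
    apply: (Lspace_norm_le (f := fun t => (`|(u - w) t| `^ p)%:E)) => //.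
    - exact/emeasurable_normr_powR/measurable_Lspace.
    - near=> t; rewrite lee_fin.
      apply: ge0_ler_powR; rewrite ?nnegrE ?(ltW p_gt0)//.
      rewrite (near vE t)// (near (LspaceB u w) t)//.
      rewrite indicE; have [|] := boolP (t \in E); last first.
        by rewrite /= mulr0n mulr0 normr0.
      rewrite inE/= => zt; rewrite mulr1n mulr1.
      have /eqP : w t * z t = 0 by near: t.
      by rewrite mulf_eq0 (negPf zt) orbF => /eqP ->; rewrite subr0.
    - by rewrite integral_Lspace.
  move=> /le_trans/(_ uw); rewrite ler_pdivlMr// ger_pMr//.
  by rewrite lern1.
near=> t; have : v t = u t * \1_E t by near: t.
rewrite v0 (near (Lspace0 mu p1) t)// indicE.
have [|] := boolP (t \in E); first by rewrite mulr1 => _ <-; rewrite mul0r.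
by rewrite notin_setE/= => /negP; rewrite negbK => /eqP ->; rewrite mulr0.
Unshelve. all: by end_near. Qed.

End disjoint_supports.

Lemma isometry_ae_disjoint (R : realType) (p : R) (p1 : (1 <= p%:E)%E)
    d (T : measurableType d) (mu : {measure set T -> \bar R})
    d' (T' : measurableType d') (nu : {measure set T' -> \bar R})
    (U : {linear LspaceType mu p1 -> LspaceType nu p1}) x y :
  2 < p -> (forall x, `|U x| = `|x|) ->
  ae_disjoint x y -> ae_disjoint (U x) (U y).
Proof.
by move=> p2 Ui /(ae_disjointP _ _ p2) xy; apply/ae_disjointP => //;
  rewrite -linearD -linearB !Ui.
Qed.

(** * Extension of a densely defined isometry *)

Section isometric_extension.
Context {R : realType} {V : normedModType R} {W : completeNormedModType R}.

(* The closure of the graph [D] is again the graph of a linear isometry, and it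
   is total because the domain of [D] is dense and [W] is complete. *)
Lemma isometric_extension (D : V -> W -> Prop) :
  (forall a x y x' y', D x y -> D x' y' -> D (a *: x + x') (a *: y + y')) ->
  (forall x y, D x y -> `|x| = `|y|) ->
  (forall x e, 0 < e -> exists x' y', D x' y' /\ `|x - x'| <= e) ->
  exists U : {linear V -> W}, (forall x, `|U x| = `|x|) /\
    (forall x e, 0 < e -> exists x' y', D x' y' /\ `|U x - y'| <= e).
Proof.
move=> Dlin Diso Ddense.
have DB x y x' y' : D x y -> D x' y' -> D (x - x') (y - y').
  move=> h h'; have := Dlin (-1) _ _ _ _ h' h.
  by rewrite !scaleN1r ![- _ + _]addrC.
pose C x y := forall e, 0 < e ->
  exists x' y', [/\ D x' y', `|x - x'| <= e & `|y - y'| <= e].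
have Clin a x y x' y' : C x y -> C x' y' -> C (a *: x + x') (a *: y + y').
  move=> h h' e e0; pose r := e / (`|a| + 1).
  have r0 : 0 < r by rewrite divr_gt0// ltr_wpDl.
  have E : `|a| * r + r = e by rewrite /r; field; rewrite gt_eqF// ltr_wpDl.
  have [u [v [Duv xu yv]]] := h _ r0; have [u' [v' [Duv' xu' yv']]] := h' _ r0.
  exists (a *: u + u'), (a *: v + v'); split; first exact: Dlin.
  - rewrite opprD addrACA -scalerBr -E (le_trans (ler_normD _ _))// lerD//.
    by rewrite normrZ ler_wpM2l.
  - rewrite opprD addrACA -scalerBr -E (le_trans (ler_normD _ _))// lerD//.
    by rewrite normrZ ler_wpM2l.
have Ciso x y : C x y -> `|x| = `|y|.
  move=> h; apply/eqP; rewrite -subr_eq0 -normr_le0 leNgt; apply/negP => d0.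
  (* The norms of [u] and [v] agree, so two errors of a third each would have to cover the whole
     gap. *)
  have [|u [v [Duv xu yv]]] := h (`| `|x| - `|y| | / 3).
    by rewrite divr_gt0.
  move: d0 xu yv; set q := `| _ - `|y| | => d0 xu yv.
  have : q <= `|x - u| + `|y - v|.
    rewrite /q -(subrKA `|u|) (le_trans (ler_normD _ _))// lerD//.
      exact: ler_dist_dist.
    by rewrite (Diso _ _ Duv) distrC ler_dist_dist.
  by move: d0 xu yv; lra.
have Ctot x : exists y, C x y.
  have /choice[u] : forall n, exists u v, D u v /\ `|x - u| <= 2^-1 ^+ n.
    by move=> n; apply: Ddense; rewrite exprn_gt0// invr_gt0.
  move=> /choice[v uv].
  (* Differences of pairs in [D] lie in [D], so the images [v n] are as close together as the
     approximations [u n] of [x]. *)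
  have uv1 n : `|v n.+1 - v n| <= 2 * 2^-1 ^+ n.
    have [D1 h1] := uv n.+1; have [D0 h0] := uv n.
    rewrite -(Diso _ _ (DB _ _ _ _ D1 D0)) distrC -(subrKA x).
    rewrite (le_trans (ler_normD _ _))// [ `|u n - x|]distrC.
    have : 0 <= 2^-1 ^+ n :> R by rewrite exprn_ge0// invr_ge0.
    move: h1 h0; rewrite exprS; lra.
  have vv := geometric_dist (ler0n _ 2) uv1.
  have /cauchy_cvg : cauchy (v @ \oo).
    by apply: geometric_cvg vv; rewrite mulr_ge0.
  move=> /cvg_ex[/= y vy]; exists y => e e0.
  have : 2^-1 ^+ n @[n --> \oo] --> (0 : R).
    by apply: cvg_expr; rewrite ger0_norm ?invr_ge0// invf_lt1// ltr1n.
  move=> /cvgr0Pnorm_le /(_ _ e0) he.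
  have /cvgrPdist_le /(_ _ e0) hy := vy.
  have [n [/= h1 h2]] := filter_ex (filterI he hy).
  have [Dn hn] := uv n; exists (u n), (v n); split => //.
  apply: le_trans hn _; move: h1; rewrite ger0_norm// exprn_ge0// invr_ge0.
have /choice[U CU] := Ctot.
have Cfun x y y' : C x y -> C x y' -> y = y'.
  move=> h h'; apply/eqP; rewrite -subr_eq0 -normr_eq0.
  have := Clin (-1) _ _ _ _ h' h.
  by rewrite !scaleN1r addNr addrC => /Ciso <-; rewrite normr0.
have Ulin : linear U.
  move=> a x y; apply: (Cfun (a *: x + y)); first exact: CU.
  by apply: Clin; exact: CU.
pose Um := GRing.isLinear.Build R V W *:%R U Ulin.
exists (HB.pack_for {linear V -> W} U Um); split => [x|x e e0].
  by rewrite -(Ciso _ _ (CU x)).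
by have [x' [y' [h _ h']]] := CU x e e0; exists x', y'.
Qed.

End isometric_extension.

(** * Linear combinations of disjoint normalized families *)

Section disjoint_families.
Context {d : measure_display} {T : measurableType d} {R : realType}.
Variables (mu : {measure set T -> \bar R}) (p : R) (p1 : (1 <= p%:E)%E).
Local Notation L := (LspaceType mu p1).

Definition disjoint_normalized (I : Type) (v : I -> L) :=
  (forall i, `|v i| = 1) /\ (forall i j, i <> j -> ae_disjoint (v i) (v j)).

Lemma disjoint_normalized_norm (I : eqType) (v : I -> L) (s : seq I) c :
  disjoint_normalized v -> uniq s ->
  `|\sum_(i <- s) c i *: v i| `^ p = \sum_(i <- s) `|c i| `^ p.
Proof.
move=> [v1 vd]; have p0 : p != 0.
  by rewrite gt_eqF// -lte_fin (lt_le_trans _ p1)// lte01.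
elim: s => [|i s IH]/=; first by rewrite !big_nil normr0 powR0.
move=> /andP[si us]; rewrite !big_cons ae_disjoint_normD ?IH//.
  by rewrite normrZ v1 mulr1.
rewrite big_seq; apply/ae_disjointC/ae_disjoint_sum => j js.
apply/ae_disjointZ/ae_disjointC/ae_disjointZ/vd => ij.
by move: si; rewrite ij js.
Qed.

(** Lists of pairs with possibly repeated indices represent formal combinations, so that addition is
    concatenation. The norm formula needs distinct indices, hence this grouping. *)
Lemma sum_undup_snd (I : eqType) (v : I -> L) (s : seq (R * I)) :
  \sum_(i <- s) i.1 *: v i.2 =
  \sum_(j <- undup (map snd s)) (\sum_(i <- s | i.2 == j) i.1) *: v j.
Proof.
under [RHS]eq_bigr do rewrite scaler_suml.
rewrite [RHS](exchange_big_dep xpredT)//=.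
rewrite big_seq [RHS]big_seq; apply: eq_bigr => i si.
have i2 : i.2 \in undup (map snd s) by rewrite mem_undup; exact: map_f.
rewrite big_mkcond (bigD1_seq i.2) ?undup_uniq//= eqxx.
by rewrite big1 ?addr0// => j ji; rewrite eq_sym (negPf ji).
Qed.

End disjoint_families.

Lemma disjoint_normalized_isometry (R : realType) (p : R) (p1 : (1 <= p%:E)%E)
    d (T : measurableType d) (mu : {measure set T -> \bar R})
    d' (T' : measurableType d') (nu : {measure set T' -> \bar R}) (I : eqType)
    (v : I -> LspaceType mu p1) (w : I -> LspaceType nu p1) (s : seq (R * I)) :
  disjoint_normalized v -> disjoint_normalized w ->
  `|\sum_(i <- s) i.1 *: v i.2| = `|\sum_(i <- s) i.1 *: w i.2|.
Proof.
move=> hv hw; have p0 : 0 < p by rewrite -lte_fin (lt_le_trans _ p1)// lte01.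
apply: (powR_injective p0); rewrite ?nnegrE//.
by rewrite !sum_undup_snd !disjoint_normalized_norm ?undup_uniq.
Qed.

(** * The space l_p(G): finite sums, unit vectors and density of their span *)

Section ell_theory.
Context {R : realType} {G : pointedType}.
Variables (p : R) (p1 : (1 <= p%:E)%E).
Local Notation D := (discrete G).
Local Notation cnt := (@counting D R : {measure set D -> \bar R}).
Local Notation L := (ell R G p1).

Let p_ge1 : 1 <= p. Proof. by move: p1; rewrite lee_fin. Qed.
Let p_gt0 : 0 < p. Proof. exact: lt_le_trans p_ge1. Qed.
Let p_neq0 : p != 0. Proof. by rewrite gt_eqF. Qed.

Lemma measurable_fun_discrete d' (T' : measurableType d') (f : D -> T') A :
  measurable_fun A f.
Proof. by []. Qed.

(** Only the empty set has counting measure 0. Elements of l_p(G) can therefore be treated as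
    genuine functions. *)
Lemma ae_counting (P : D -> Prop) : (\forall t \ae cnt, P t) -> forall t, P t.
Proof.
move=> [A [_ A0 PA]] t; apply: contrapT => nPt; have At : A t by exact: PA.
move: A0; rewrite /= /counting; case: ifPn => [/asboolP fA [] /eqP|//].
rewrite pnatr_eq0 size_eq0 => /eqP fA0.
have : t \in fset_set A by rewrite in_fset_set//; exact: mem_set.
by rewrite -[_ \in _]/(t \in enum_fset _) fA0.
Qed.

Lemma counting_set1 (t : D) : cnt [set t] = 1%E.
Proof.
by rewrite /= /counting asboolT// fset_set1 -[size _]/(#|` _|%fset) cardfs1.
Qed.

Lemma integral_counting_seq (f : D -> R) (s : seq D) : (forall t, 0 <= f t) ->
  uniq s -> (\int[cnt]_(t in [set` s]) (f t)%:E = (\sum_(t <- s) f t)%:E)%E.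
Proof.
move=> f0 us; rewrite integral_mkcond.
transitivity (\int[cnt]_t \sum_(i <- s) ((f i)%:E * (\1_[set i] t)%:E))%E.
  apply: eq_integral => t _; rewrite patchE mem_setE.
  case: ifPn => ts; last first.
    rewrite big1_seq// => i /andP[_ si]; rewrite indicE memNset ?mule0//=.
    by move=> ti; move: ts; rewrite ti si.
  rewrite (bigD1_seq t)//= big1 ?adde0 => [|i it].
    by rewrite indicE mem_set// mule1.
  by rewrite indicE memNset ?mule0//= => ti; rewrite ti eqxx in it.
rewrite ge0_integral_sum//; last first.
  by move=> i t _; rewrite mule_ge0// lee_fin.
rewrite -sumEFin; apply: eq_bigr => i _.
rewrite ge0_integralZl_EFin//.
by rewrite integral_indic// setIT counting_set1 mule1.
Qed.

(** The support of [f] is the increasing union of the sets [F n], which are finite by hypothesis;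
    monotone convergence makes the integral a limit of finite sums. *)
Lemma integral_counting_approx (f : D -> R) (e : \bar R) :
  (forall t, 0 <= f t) -> (forall c, 0 < c -> finite_set [set t | c <= f t]) ->
  (e < \int[cnt]_t (f t)%:E)%E ->
  exists2 s, uniq s & (e < (\sum_(t <- s) f t)%:E)%E.
Proof.
move=> f0 ff ef; apply: contrapT => H.
pose F n := [set t | n.+1%:R^-1 <= f t].
suff : (\int[cnt]_t (f t)%:E <= e)%E by rewrite leNgt ef.
have -> : (\int[cnt]_t (f t)%:E = \int[cnt]_(t in \bigcup_n F n) (f t)%:E)%E.
  rewrite [RHS]integral_mkcond; apply: eq_integral => t _; rewrite patchE.
  case: ifPn => //; rewrite notin_setE => Ft.
  apply/eqP; rewrite eqe eq_le f0 andbT leNgt; apply/negP => ft.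
  apply: Ft; have [n hn] := ltr_add_invr (y := 0) ft.
  by exists n => //=; rewrite add0r in hn; exact: ltW.
apply: (cvge_to_le (ge0_nondecreasing_set_cvg_integral _ _ _ _)).
- apply/nondecreasing_seqP => n; apply/subsetPset => t; apply: le_trans.
  by rewrite lef_pV2 ?posrE// ler_nat.
- by [].
- by move=> n; exact: measurable_fun_discrete.
- by move=> n t _; rewrite lee_fin.
apply: nearW => n; have [|s Fs] := (finite_seqP _).1 (ff n.+1%:R^-1 _).
  by rewrite invr_gt0.
have -> : F n = [set` undup s].
  by rewrite /F Fs; apply/seteqP; split => t /=; rewrite mem_undup.
rewrite integral_counting_seq ?undup_uniq// leNgt; apply/negP => es.
by apply: H; exists (undup s) => //; exact: undup_uniq.
Qed.

(** Markov's inequality: [c] times the indicator of an infinite set already has infinite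
    integral. *)
Lemma finite_superlevel (f : D -> R) c : (forall t, 0 <= f t) -> 0 < c ->
  (\int[cnt]_t (f t)%:E < +oo)%E -> finite_set [set t | c <= f t].
Proof.
move=> f0 c0; apply: contraPP => iA; apply/negP; rewrite -leNgt.
pose A := [set t | c <= f t].
have <- : (\int[cnt]_t (c%:E * (\1_A t)%:E) = +oo)%E.
  rewrite ge0_integralZl_EFin// ?(ltW c0)//.
  rewrite integral_indic// setIT /= /counting asboolF//.
  by rewrite gt0_muley// lte_fin.
apply: ge0_le_integral => //.
- by move=> t _; rewrite mule_ge0// lee_fin// ltW.
- move=> t _; rewrite indicE -EFinM lee_fin.
  have [|_] := boolP (t \in A); last by rewrite /= mulr0n mulr0.
  by move=> /set_mem; rewrite /A /= mulr1.
Qed.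

Lemma ell_of_fun (b : D -> R) (M : R) : 0 <= M ->
  (forall s, uniq s -> \sum_(t <- s) `|b t| `^ p <= M `^ p) ->
  exists a : L, (forall t, a t = b t) /\ `|a| <= M.
Proof.
move=> M0 bM; have b0 t : 0 <= `|b t| `^ p by exact: powR_ge0.
have intb : (\int[cnt]_t (`|b t| `^ p)%:E <= (M `^ p)%:E)%E.
  rewrite leNgt; apply/negP => /integral_counting_approx h.
  have [//|c c0|s us] := h.
    (* N + 1 points with values at least [c] have a sum of at least (N + 1) c > M^p, against
       [bM]. *)
    apply: contrapT => iA; pose N := Num.truncn (M `^ p / c).
    have [B BA NB] := infinite_set_fset N.+1 iA.
    have := bM _ (fset_uniq B); apply/negP; rewrite -ltNge.
    apply: (@lt_le_trans _ _ (N.+1%:R * c)).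
      by rewrite -ltr_pdivrMr// truncnS_gt.
    apply: (@le_trans _ _ (\sum_(t <- enum_fset B) c)).
      rewrite big_const_seq count_predT iter_addr_0 -[c *+ _]mulr_natl.
      by rewrite ler_pM2r// ler_nat.
    by rewrite big_seq [leRHS]big_seq; apply: ler_sum => t tB; exact: BA.
  by rewrite lte_fin ltNge bM.
have mb : measurable_fun setT b by exact: measurable_fun_discrete.
have [|a ab] := @Lspace_of_fun _ _ _ cnt p p1 b mb.
  exact: le_lt_trans intb (ltry _).
exists a; split; first exact: ae_counting.
apply: (Lspace_norm_le M0 (f := fun t => (`|b t| `^ p)%:E)) => //.
by apply: filterS ab => t ->.
Qed.

Lemma ell_ext (a b : L) : (forall t, a t = b t) -> a = b.
Proof. by move=> ab; apply/LspaceP; exact: nearW. Qed.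

Lemma ellD (a b : L) t : (a + b) t = a t + b t.
Proof. exact: (ae_counting (LspaceD a b)). Qed.

Lemma ellZ c (a : L) t : (c *: a) t = c * a t.
Proof. exact: (ae_counting (LspaceZ c a)). Qed.

Lemma ellB (a b : L) t : (a - b) t = a t - b t.
Proof. exact: (ae_counting (LspaceB a b)). Qed.

Lemma ell_sum (I : Type) (r : seq I) (x : I -> L) t :
  (\sum_(i <- r) x i) t = \sum_(i <- r) x i t.
Proof.
elim: r => [|i r IH]; last by rewrite !big_cons ellD IH.
by rewrite !big_nil; exact: (ae_counting (Lspace0 _ _)).
Qed.

Lemma ell_unit_subproof (g : D) :
  exists a : L, (forall t, a t = (t == g)%:R) /\ `|a| <= 1.
Proof.
apply: ell_of_fun => // s us; rewrite powR1.
have [gs|gs] := boolP (g \in s); last first.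
  rewrite big1_seq// => t /andP[_ ts]; case: eqP => [tg|_].
    by move: gs; rewrite -tg ts.
  by rewrite normr0 powR0.
rewrite (bigD1_seq g)//= eqxx normr1 powR1 big1 ?addr0// => t /negPf ->.
by rewrite normr0 powR0.
Qed.

Definition ell_unit (g : D) : L := projT1 (cid (ell_unit_subproof g)).

Lemma ell_unitE g t : ell_unit g t = (t == g)%:R.
Proof. by rewrite /ell_unit; case: cid => a []. Qed.

Lemma ell_unit_disjoint (a : L) g : a g = 0 -> ae_disjoint a (ell_unit g).
Proof.
move=> ag; apply: nearW => t; rewrite ell_unitE.
by have [->|_] := eqVneq t g; rewrite ?ag ?mul0r ?mulr0.
Qed.

Lemma ell_unit_disjoint_normalized : disjoint_normalized ell_unit.
Proof.
split=> [g|g h gh]; last first.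
  by apply: ell_unit_disjoint; rewrite ell_unitE; case: eqP => // /esym.
apply: (powR_injective p_gt0); rewrite ?nnegrE// powR1; apply: EFin_inj.
rewrite -integral_Lspace (_ : 1%:E = (\sum_(t <- [:: g]) 1%R)%:E)%E; last first.
  by rewrite big_seq1.
rewrite -integral_counting_seq// [RHS]integral_mkcond.
apply: eq_integral => t _.
rewrite patchE mem_setE inE ell_unitE.
by case: ifPn => _; rewrite ?normr1 ?powR1// normr0 powR0.
Qed.

(** Some finite [s] carries all but e^p of |a|^p. The truncation [u] and the remainder [a - u] are
    disjoint, so their p-th powers of norms add up to |a|^p and the remainder has norm at most
    [e]. *)
Lemma ell_dense (a : L) e : 0 < e ->
  exists s : seq D, `|a - \sum_(g <- s) a g *: ell_unit g| <= e.
Proof.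
move=> e0; have f0 t : 0 <= `|a t| `^ p by exact: powR_ge0.
have [| |s us] := @integral_counting_approx (fun t => `|a t| `^ p)
  ((`|a| `^ p - e `^ p)%:E) f0.
- by move=> c c0; apply: finite_superlevel => //; rewrite integral_Lspace ltry.
- by rewrite integral_Lspace lte_fin ltrBlDr ltrDl powR_gt0.
rewrite lte_fin -(disjoint_normalized_norm _ ell_unit_disjoint_normalized us).
set u := \sum_(_ <- s) _ => au; exists s; rewrite -/u.
have uE t : u t = if t \in s then a t else 0.
  rewrite ell_sum; case: ifPn => ts; last first.
    rewrite big1_seq// => i /andP[_ si]; rewrite ellZ ell_unitE.
    by case: eqP => [ti|_]; [rewrite ti si in ts|rewrite mulr0].
  rewrite (bigD1_seq t)//= big1 ?addr0 => [|i /negPf it].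
    by rewrite ellZ ell_unitE eqxx mulr1.
  by rewrite ellZ ell_unitE eq_sym it mulr0.
have ud : ae_disjoint u (a - u).
  apply: nearW => t; rewrite ellB uE; case: ifP => _; last by rewrite mul0r.
  by rewrite subrr mulr0.
have := ae_disjoint_normD ud; rewrite subrKC => E.
move: au; rewrite E ltrBlDr ltrD2l; apply: contraTT; rewrite -ltNge -leNgt => h.
by rewrite ge0_ler_powR ?nnegrE ?(ltW p_gt0) ?(ltW e0) ?(ltW h).
Qed.

End ell_theory.

(** Sending unit vectors to the [v g] preserves norms of finite combinations, so it extends to all
    of l_p(G) by density; since [X] is closed, the limits stay in it. *)
Lemma ell_isometry (R : realType) (G : pointedType) (p : R)
    (p1 : (1 <= p%:E)%E) d (T : measurableType d)
    (mu : {measure set T -> \bar R}) (X : set (LspaceType mu p1))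
    (v : discrete G -> LspaceType mu p1) :
  closed_subspace X -> (forall g, X (v g)) -> disjoint_normalized v ->
  embeds_isometrically (ell R G p1) X.
Proof.
move=> [Xcl [X0 Xlin]] Xv dv.
have Xsum (s : seq (R * discrete G)) : X (\sum_(i <- s) i.1 *: v i.2).
  elim: s => [|i s IH]; first by rewrite big_nil; exact: set_mem X0.
  rewrite big_cons.
  exact: set_mem (Xlin _ _ _ (mem_set (Xv _)) (mem_set IH)).
(* A relation, because one [x] is represented by many lists; that the image is well defined follows
   from preservation of norms. *)
pose D (x : ell R G p1) y := exists s : seq (R * discrete G),
  x = \sum_(i <- s) i.1 *: ell_unit p1 i.2 /\ y = \sum_(i <- s) i.1 *: v i.2.
have [||x e e0|U [Uiso Uapp]] := @isometric_extension R _ (LspaceType mu p1) D.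
- move=> a x y x' y' [s [-> ->]] [s' [-> ->]].
  exists ([seq (a * i.1, i.2) | i <- s] ++ s').
  rewrite !big_cat !big_map !scaler_sumr/=.
  by split; congr (_ + _); apply: eq_bigr => i _; rewrite scalerA.
- move=> x y [s [-> ->]].
  exact: disjoint_normalized_isometry (ell_unit_disjoint_normalized _) dv.
- have [s xs] := ell_dense x e0.
  exists (\sum_(g <- s) x g *: ell_unit p1 g), (\sum_(g <- s) x g *: v g).
  by split => //; exists [seq (x g, g) | g <- s]; rewrite !big_map.
exists U; split => // _ [x _ <-]; apply: Xcl => B /nbhs_ballP[e /= e0 eB].
have [|x' [y' [[s [_ ->]] h]]] := Uapp x (e / 2); first by rewrite divr_gt0.
exists (\sum_(i <- s) i.1 *: v i.2); split => //; apply: eB.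
rewrite -ball_normE/=; apply: le_lt_trans h _.
by rewrite ltr_pdivrMr// ltr_pMr// ltr1n.
Qed.

(** * Signed sums in a Hilbert space, and the implication from (c) to (d) *)

Section hilbert_signs.
Context {R : realType} {H : completeNormedModType R}.

(** By the parallelogram law, one of |b + w i|^2 and |b - w i|^2 is at least |w i|^2 + |b|^2; this
    chooses the sign of each new term. *)
Lemma hilbert_signs (I : eqType) (w : I -> H) (s : seq I) :
  is_hilbert H -> uniq s ->
  exists a : I -> R, (forall i, `|a i| = 1) /\
    \sum_(i <- s) `|w i| ^+ 2 <= `|\sum_(i <- s) a i *: w i| ^+ 2.
Proof.
move=> [ip ipE]; elim: s => [_|i s IH /= /andP[si us]].
  by exists (fun=> 1); split=> [_|]; rewrite ?normr1// !big_nil normr0 expr0n.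
have [a [a1 ha]] := IH us; set b := \sum_(j <- s) a j *: w j in ha.
have par :
    `|w i + b| ^+ 2 + `|- w i + b| ^+ 2 = 2 * `|w i| ^+ 2 + 2 * `|b| ^+ 2.
  have D x y : ip (x + y) (x + y) = ip x x + ip x y + (ip y x + ip y y).
    by rewrite linearDl !linearDr.
  have Nl x y : ip (- x) y = - ip x y by rewrite linearNl.
  have Nr x y : ip x (- y) = - ip x y by rewrite linearNr.
  by rewrite !ipE !D !Nl !Nr opprK; ring.
have ext c : \sum_(j <- s) (if j == i then c else a j) *: w j = b.
  rewrite /b big_seq [RHS]big_seq; apply: eq_bigr => j js.
  by case: eqP => // ji; rewrite -ji js in si.
have [h|h] := leP (`|w i| ^+ 2 + `|b| ^+ 2) (`|w i + b| ^+ 2).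
  exists (fun j => if j == i then 1 else a j); split.
    by move=> j; case: ifP; rewrite ?normr1.
  rewrite !big_cons eqxx scale1r ext; apply: le_trans h.
  by rewrite lerD2l.
exists (fun j => if j == i then -1 else a j); split.
  by move=> j; case: ifP; rewrite ?normrN1.
rewrite !big_cons eqxx scaleN1r ext.
apply: (@le_trans _ _ (`|w i| ^+ 2 + `|b| ^+ 2)); first by rewrite lerD2l.
by move: par h; lra.
Qed.

End hilbert_signs.

Lemma not_injects_in_hilbert (R : realType) (G : pointedType) (p : R)
    (p1 : (1 <= p%:E)%E) (V : normedModType R) (X : set V) :
  2 < p -> ~ countable [set: G] ->
  embeds_isomorphically (ell R G p1) X -> ~ injects_in_hilbert X.
Proof.
move=> p2 Gunc [Y [_ YX [f [fY [c [C [c0 fC]]]]]]].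
move=> [H [Hhilb [S [Slin [K SK] Sinj]]]].
have p0 : 0 < p by exact: lt_trans p2.
have Xf u : X (f u) by apply: YX; rewrite -fY; exists u.
pose Sf u := S (f u).
have Sflin a u v : Sf (a *: u + v) = a *: Sf u + Sf v.
  by rewrite /Sf linearP Slin.
have Sf0 : Sf 0 = 0.
  have := Sflin 1 0 0; rewrite !scale1r addr0 => /eqP.
  by rewrite -subr_eq0 opprD addrA subrr sub0r oppr_eq0 => /eqP.
have Sfsum (s : seq (discrete G)) a :
    Sf (\sum_(g <- s) a g *: ell_unit p1 g) =
    \sum_(g <- s) a g *: Sf (ell_unit p1 g).
  by elim: s => [|g s IH]; rewrite ?big_nil// !big_cons Sflin IH.
have [e1 ed] := ell_unit_disjoint_normalized (R := R) (G := G) p1.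
pose w g := Sf (ell_unit p1 g).
have w0 g : 0 < `|w g|.
  rewrite normr_gt0; apply/eqP => wg0.
  have : f (ell_unit p1 g) = f 0.
    apply: Sinj; [exact/mem_set/Xf|exact/mem_set/Xf|].
    by rewrite -[LHS]/(w g) wg0 -[RHS]/(Sf 0).
  rewrite linear0 => fe0; have /andP[+ _] := fC (ell_unit p1 g).
  by rewrite fe0 normr0 e1 mulr1 leNgt c0.
(* If these sets were all finite, their union over [n], which is [G], would be countable. *)
have [n Wn] : exists n, infinite_set [set g | n.+1%:R^-1 <= `|w g|].
  apply: contrapT => W; apply: Gunc.
  have -> : [set: G] = \bigcup_n [set g | n.+1%:R^-1 <= `|w g|].
    apply/seteqP; split=> // g _; have [n hn] := ltr_add_invr (y := 0) (w0 g).
    by exists n => //=; rewrite add0r in hn; exact: ltW.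
  apply: bigcup_countable => // n _; apply: finite_set_countable.
  by apply: contrapT => Wn; apply: W; exists n.
pose del : R := n.+1%:R^-1; have del0 : 0 < del by rewrite invr_gt0.
(* [M] bounds the squared norm of [Sf]; the absolute values make the bounds monotone, whatever the
   signs of [K] and [C]. *)
pose M := (`|K| * `|C|) ^+ 2; have M0 : 0 <= M by exact: sqr_ge0.
pose th := 1 - 2 / p; have th0 : 0 < th by rewrite subr_gt0 ltr_pdivrMr// mul1r.
pose Q := M / del ^+ 2; have Q0 : 0 <= Q by rewrite divr_ge0// sqr_ge0.
(* With m > N unit vectors, the two estimates m del^2 <= M m^(2/p) would give m^th <= Q, while the
   choice of [N] gives m^th > Q. *)
pose N := Num.truncn (Q `^ th^-1).
have [B BW NB] := infinite_set_fset N.+1 Wn.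
pose m : R := (size (enum_fset B))%:R.
have m0 : 0 < m by rewrite ltr0n (leq_trans _ NB).
have [a [a1 ha]] := hilbert_signs w Hhilb (fset_uniq B).
pose x := \sum_(g <- enum_fset B) a g *: ell_unit p1 g.
have xp : `|x| `^ p = m.
  rewrite disjoint_normalized_norm ?fset_uniq//.
  under eq_bigr do rewrite a1 powR1.
  by rewrite big_const_seq count_predT iter_addr_0.
have x2 : `|x| ^+ 2 = m `^ (2 / p).
  by rewrite -xp -powRrM mulrC divfK ?gt_eqF// powR_mulrn.
have lower : m * del ^+ 2 <= `|\sum_(g <- enum_fset B) a g *: w g| ^+ 2.
  apply: le_trans ha.
  apply: (@le_trans _ _ (\sum_(g <- enum_fset B) del ^+ 2)).
    by rewrite big_const_seq count_predT iter_addr_0 -[_ ^+ 2 *+ _]mulr_natl.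
  rewrite big_seq [leRHS]big_seq; apply: ler_sum => g gB.
  by rewrite lerXn2r ?nnegrE ?(ltW del0)//; exact: BW.
have upper : `|\sum_(g <- enum_fset B) a g *: w g| ^+ 2 <= M * m `^ (2 / p).
  rewrite -Sfsum -x2 /M -exprMn lerXn2r ?nnegrE ?mulr_ge0//.
  apply: le_trans (SK _ (Xf _)) _.
  apply: (@le_trans _ _ (`|K| * `|f x|)); first by rewrite ler_wpM2r// ler_norm.
  rewrite -mulrA ler_wpM2l//; have /andP[_ h] := fC x.
  by apply: le_trans h _; rewrite ler_wpM2r// ler_norm.
have mE : m = m `^ (2 / p) * m `^ th.
  rewrite -powRD ?(gt_eqF m0) ?implybT// /th subrKC.
  by rewrite powRr1// ltW.
have : m `^ th <= Q.
  rewrite ler_pdivlMr ?exprn_gt0// -(ler_pM2l (powR_gt0 (2 / p) m0)).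
  by rewrite mulrA -mE [leRHS]mulrC (le_trans lower).
apply/negP; rewrite -ltNge.
have QN : Q `^ th^-1 < m.
  by apply: lt_le_trans (truncnS_gt _) _; rewrite ler_nat.
rewrite -[ltLHS]powRr1// -(mulVf (lt0r_neq0 th0)) powRrM.
by rewrite gt0_ltr_powR ?nnegrE ?powR_ge0// ltW.
Qed.

(** * The duality pairing and the projection that leads from (a) to (b) *)

Lemma ae_eq_Rintegral d (T : measurableType d) (R : realType)
    (mu : {measure set T -> \bar R}) (h k : T -> R) : measurable_fun setT h ->
  measurable_fun setT k -> (\forall t \ae mu, h t = k t) ->
  \int[mu]_t h t = \int[mu]_t k t.
Proof.
move=> mh mk hk; rewrite /Rintegral; congr fine; apply: ae_eq_integral => //.
- exact/measurable_EFinP.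
- exact/measurable_EFinP.
- by apply: filterS hk => t -> _.
Qed.

Section duality_pairing.
Context {d : measure_display} {T : measurableType d} {R : realType}.
Variables (mu : {measure set T -> \bar R}) (p : R) (p1 : (1 <= p%:E)%E).
Context (p2 : 2 <= p).
Local Notation L := (LspaceType mu p1).
Implicit Types f g u v y : L.

Let p_ge1 : 1 <= p. Proof. by move: p1; rewrite lee_fin. Qed.
Let p_gt0 : 0 < p. Proof. exact: lt_le_trans p_ge1. Qed.
Let p_neq0 : p != 0. Proof. by rewrite gt_eqF. Qed.

(* Up to normalization, [fun f => Lspace_pair f u] is the norming functional of
   [u]. For [p = 2] it is the inner product, since [0 `^ 0 = 1]. *)
Definition Lspace_pair f u : R :=
  \int[mu]_t (f t * (u t * `|u t| `^ (p - 2))).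

Lemma integrable_Lspace_pair f u :
  mu.-integrable setT (EFin \o (fun t => f t * (u t * `|u t| `^ (p - 2)))).
Proof.
have mf := measurable_Lspace f; have mu' := measurable_Lspace u.
have iD : mu.-integrable setT
    (fun t => (`|f t| `^ p)%:E + (`|u t| `^ p)%:E)%E.
  by apply: integrableD => //; exact: integrable_Lspace.
apply: le_integrable iD => //.
  apply/measurable_EFinP/measurable_funM => //.
  by apply: measurable_funM => //; exact: measurable_normr_powR.
move=> t _ /=; rewrite lee_fin [leRHS]ger0_norm ?addr_ge0 ?powR_ge0//.
have := @mul_powR_le _ 1 (p - 1) (f t) (u t).
rewrite subrKC powRr1// => h; apply: le_trans (h _ _ _) => //; last first.
  by rewrite subr_ge0.
rewrite !normrM (ger0_norm (powR_ge0 _ _)) ler_wpM2l//.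
rewrite (_ : p - 2 = p - 1 - 1); last by ring.
by rewrite mulr_powRB1// subr_gt0 (lt_le_trans _ p2)// ltr1n.
Qed.

Lemma measurable_Lspace_pair f u :
  measurable_fun setT (fun t => f t * (u t * `|u t| `^ (p - 2))).
Proof.
by have /integrableP[/measurable_EFinP] := integrable_Lspace_pair f u.
Qed.

Lemma Lspace_pairPl a f g u :
  Lspace_pair (a *: f + g) u = a * Lspace_pair f u + Lspace_pair g u.
Proof.
have mf := measurable_Lspace_pair f u; have mg := measurable_Lspace_pair g u.
rewrite /Lspace_pair -RintegralZl//; last exact: integrable_Lspace_pair.
have iaf : mu.-integrable setT
    (EFin \o (fun t => a * (f t * (u t * `|u t| `^ (p - 2))))).
  exact: (integrableZl measurableT a (integrable_Lspace_pair f u)).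
rewrite -(RintegralD measurableT iaf (integrable_Lspace_pair g u)).
apply: ae_eq_Rintegral.
- exact: (measurable_Lspace_pair (a *: f + g) u).
- by apply: measurable_funD => //; exact: measurable_funM.
- near=> t; rewrite (near (LspaceD (a *: f) g) t)// (near (LspaceZ a f) t)//.
  by rewrite mulrDl -[a * _ * _]mulrA.
Unshelve. all: by end_near. Qed.

Lemma Lspace_pairxx u : Lspace_pair u u = `|u| `^ p.
Proof.
rewrite -[RHS]/(fine (`|u| `^ p)%:E) -integral_Lspace; congr fine.
apply: eq_integral => t _; congr EFin; have [->|ut] := eqVneq (u t) 0.
  by rewrite mul0r normr0 powR0.
rewrite mulrA -expr2 -real_normK ?num_real// -powR_mulrn//.
by rewrite -powRD ?subrKC// normr_eq0 ut implybT.
Qed.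

Lemma Lspace_pair_disjoint f u : ae_disjoint f u -> Lspace_pair f u = 0.
Proof.
move=> fu; rewrite /Lspace_pair (@ae_eq_Rintegral _ _ _ _ _ (cst 0)).
- by rewrite /Rintegral integral0.
- exact: (measurable_Lspace_pair f u).
- exact: measurable_cst.
- by apply: filterS fu => t; rewrite mulrA => ->; rewrite mul0r.
Qed.

Lemma Lspace_pairZr f u a :
  Lspace_pair f (a *: u) = a * `|a| `^ (p - 2) * Lspace_pair f u.
Proof.
rewrite /Lspace_pair -RintegralZl//; last exact: integrable_Lspace_pair.
apply: ae_eq_Rintegral.
- exact: (measurable_Lspace_pair f (a *: u)).
- by apply: measurable_funM => //; exact: (measurable_Lspace_pair f u).
- near=> t; rewrite (near (LspaceZ a u) t)// normrM powRM//; ring.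
Unshelve. all: by end_near. Qed.

(** The function s |s|^(p-2) need not be additive, but it is so on two numbers one of which is 0. *)
Lemma Lspace_pairDr f u v : ae_disjoint u v ->
  Lspace_pair f (u + v) = Lspace_pair f u + Lspace_pair f v.
Proof.
move=> uv; rewrite /Lspace_pair.
rewrite -RintegralD//; [|exact: integrable_Lspace_pair..].
apply: ae_eq_Rintegral.
- exact: (measurable_Lspace_pair f (u + v)).
- apply: measurable_funD; first exact: (measurable_Lspace_pair f u).
  exact: (measurable_Lspace_pair f v).
- near=> t; rewrite (near (LspaceD u v) t)//.
  have /eqP : u t * v t = 0 by near: t.
  rewrite mulf_eq0 => /orP[]/eqP ->; first by rewrite !add0r mul0r mulr0 add0r.
  by rewrite !addr0 mul0r mulr0 addr0.
Unshelve. all: by end_near. Qed.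

(** Integrates [mul_powRB1_le], a substitute for the Hölder inequality whose coefficient 1/2 allows
    the power of |y| to be absorbed. *)
Lemma Lspace_pair_le f y :
  Lspace_pair f y <= `|y| `^ p / 2 + 2 `^ p * `|f| `^ p.
Proof.
have iy : mu.-integrable setT (fun t => (2^-1)%:E * (`|y t| `^ p)%:E)%E.
  by apply: integrableZl => //; exact: integrable_Lspace.
have if' : mu.-integrable setT (fun t => (2 `^ p)%:E * (`|f t| `^ p)%:E)%E.
  by apply: integrableZl => //; exact: integrable_Lspace.
rewrite -lee_fin /Lspace_pair /Rintegral fineK; last first.
  exact: integrable_fin_num (integrable_Lspace_pair f y).
rewrite EFinD mulrC !EFinM -!integral_Lspace.
rewrite -!integralZl//; [|exact: integrable_Lspace..].
rewrite -(integralD measurableT iy if'); apply: le_integral => //.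
- exact: integrable_Lspace_pair.
- exact: integrableD.
- move=> t _; rewrite -!EFinM -EFinD lee_fin.
  apply: le_trans (_ : `|f t| * `|y t| `^ (p - 1) <= _); last first.
    by rewrite [2^-1 * _]mulrC; exact: mul_powRB1_le.
  apply: le_trans (ler_norm _) _.
  rewrite !normrM (ger0_norm (powR_ge0 _ _)) ler_wpM2l//.
  rewrite (_ : p - 2 = p - 1 - 1); last by ring.
  by rewrite mulr_powRB1// subr_gt0 (lt_le_trans _ p2)// ltr1n.
Qed.

Lemma Lspace_pair_sumr (I : eqType) (u : I -> L) (s : seq I) c f :
  disjoint_normalized u -> uniq s ->
  Lspace_pair f (\sum_(i <- s) c i *: u i) =
  \sum_(i <- s) c i * `|c i| `^ (p - 2) * Lspace_pair f (u i).
Proof.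
move=> [_ ud]; elim: s => [_|i s IH /= /andP[si us]].
  rewrite !big_nil; apply/Lspace_pair_disjoint/ae_disjointC.
  exact: ae_disjoint0.
rewrite !big_cons Lspace_pairDr ?Lspace_pairZr ?IH//.
rewrite big_seq; apply/ae_disjointC/ae_disjoint_sum => j js.
apply/ae_disjointZ/ae_disjointC/ae_disjointZ/ud => ij.
by move: si; rewrite ij js.
Qed.

(** Pair [f] with [y], the combination of the [u i] with coefficients [c i]: both the pairing and
    |y|^p equal the sum of the |c i|^p. Absorbing |y|^p / 2 in [Lspace_pair_le] leaves 2 * 2^p
    |f|^p, at most (4 |f|)^p. *)
Lemma Lspace_pair_bessel (I : eqType) (u : I -> L) (s : seq I) f :
  disjoint_normalized u -> uniq s ->
  \sum_(i <- s) `|Lspace_pair f (u i)| `^ p <= (4 * `|f|) `^ p.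
Proof.
move=> du us; pose c i := Lspace_pair f (u i).
pose y := \sum_(i <- s) c i *: u i.
have yp : `|y| `^ p = \sum_(i <- s) `|c i| `^ p.
  exact: disjoint_normalized_norm.
have fy : Lspace_pair f y = `|y| `^ p.
  rewrite Lspace_pair_sumr// yp; apply: eq_bigr => i _; rewrite -/(c i).
  have [->|ci] := eqVneq (c i) 0; first by rewrite mulr0 normr0 powR0.
  rewrite mulrAC -expr2 -real_normK ?num_real// -powR_mulrn//.
  by rewrite -powRD ?subrKC// normr_eq0 ci implybT.
have := Lspace_pair_le f y; rewrite fy -yp => h.
have h2 : `|y| `^ p <= 2 * (2 `^ p * `|f| `^ p) by move: h; lra.
apply: le_trans h2 _; rewrite (_ : 4 = 2 * 2); last by rewrite -natrM.
rewrite -mulrA [leRHS]powRM ?mulr_ge0// -powRM// ler_wpM2r ?powR_ge0//.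
by rewrite le1r_powR ?ler1n.
Qed.

End duality_pairing.

Lemma isometric_copy_complemented (R : realType) (G : pointedType) (p : R)
    (p1 : (1 <= p%:E)%E) d (T : measurableType d)
    (mu : {measure set T -> \bar R}) (X : set (LspaceType mu p1)) :
  2 < p -> embeds_isometrically (ell R G p1) X ->
  exists Y : set (LspaceType mu p1),
    [/\ closed_subspace Y, Y `<=` X, isomorphic_to (ell R G p1) Y
      & complemented Y].
Proof.
move=> p2 [U [UX Uiso]]; have p2' := ltW p2.
pose u g := U (ell_unit p1 g).
have du : disjoint_normalized u.
  have [e1 ed] := ell_unit_disjoint_normalized (R := R) (G := G) p1.
  split=> [g|g h gh]; first by rewrite /u Uiso e1.
  by apply: isometry_ae_disjoint => //; exact: ed.
have /choice[Q QP] : forall f : LspaceType mu p1, exists a : ell R G p1,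
    (forall g, a g = Lspace_pair f (u g)) /\ `|a| <= 4 * `|f|.
  move=> f; apply: ell_of_fun => [|s us]; first by rewrite mulr_ge0.
  exact: Lspace_pair_bessel.
have Qlin : linear Q.
  move=> a f g; apply: ell_ext => t.
  by rewrite ellD ellZ !(QP _).1 Lspace_pairPl.
(* Without its g-th term, [a] is disjoint from the g-th unit vector, and [U] preserves this. Only
   the g-th term contributes to the pairing with [u g]. *)
have QU a : Q (U a) = a.
  apply: ell_ext => g; rewrite (QP _).1.
  rewrite -[a in U a](subrKC (a g *: ell_unit p1 g)) linearD linearZ/=.
  rewrite Lspace_pairPl// Lspace_pairxx// du.1 powR1 mulr1.
  rewrite Lspace_pair_disjoint ?addr0//; apply: isometry_ae_disjoint => //.
  by apply: ell_unit_disjoint; rewrite ellB ellZ ell_unitE eqxx mulr1 subrr.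
pose P := U \o Q.
have Plin : linear P by move=> a f g; rewrite /P /= Qlin linearP.
pose PL := HB.pack_for {linear LspaceType mu p1 -> LspaceType mu p1} P
  (GRing.isLinear.Build R _ _ *:%R P Plin).
have PP x : P (P x) = P x by rewrite /P /= QU.
have Pb x : `|P x| <= 4 * `|x| by rewrite /P /= Uiso; exact: (QP x).2.
have rP : range P = range U.
  apply/seteqP; split=> [_ [x _ <-]|_ [a _ <-]]; first by exists (Q x).
  by exists (U a) => //; rewrite /P /= QU.
exists (range U); split => //.
- split=> [x clx|]; last first.
    split=> [|a _ _ /set_mem[x _ <-] /set_mem[y _ <-]].
      by apply: mem_set; exists 0; rewrite ?linear0.
    by apply: mem_set; exists (a *: x + y) => //; rewrite linearP.
  suff Px : P x = x by rewrite -rP -Px; exists x.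
  apply/eqP; rewrite -subr_eq0 -normr_le0 leNgt; apply/negP => h.
  (* Any [y] in the range is fixed by [P], so |P x - x| <= |P (x - y)| + |x - y| <= 5 |x - y|. This
     shows that the range is closed. *)
  pose e := `|P x - x| / 5; have e0 : 0 < e by rewrite divr_gt0.
  have [y [[a _ Ua]]] := clx _ (nbhsx_ballx x e e0).
  rewrite -ball_normE/= => xy.
  have : `|P x - x| <= 4 * `|x - y| + `|x - y|.
    rewrite -{1}(subrKA (P y)) (le_trans (ler_normD _ _))// lerD//.
      by rewrite -[P x - P y](linearB PL) Pb.
    by rewrite distrC (_ : P y = y)// -Ua /P /= QU.
  by move: xy; rewrite /e; lra.
- exists U; split => //; exists 1, 1; split => // a.
  by rewrite mul1r Uiso lexx.
- exists PL; split => //.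
  by exists 4 => x _; exact: Pb.
Qed.

(** * L_2 as a Hilbert space *)

Section hilbert_Lspace2.
Context {d : measure_display} {T : measurableType d} {R : realType}.
Variables (mu : {measure set T -> \bar R}) (q1 : (1 <= (2 : R)%:E)%E).
Local Notation L := (LspaceType mu q1).

Definition Lspace_dot (x y : L) : R := Lspace_pair x y.

Let dotC (x y : L) : Lspace_dot x y = Lspace_dot y x.
Proof.
apply: eq_Rintegral => t _.
by rewrite !subrr !powRr0 !mulr1 mulrC.
Qed.

Let dot_linearl (y : L) : linear_for *%R (Lspace_dot^~ y).
Proof. by move=> a x x'; exact: Lspace_pairPl. Qed.

Let dot_bilinear : bilinear_for *%R (idfun \; *%R) Lspace_dot.
Proof.
split=> [y|x]; first exact: dot_linearl.
by move=> a y y'; rewrite !(dotC x) dot_linearl.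
Qed.

HB.instance Definition _ :=
  bilinear_isBilinear.Build R L L R *%R (idfun \; *%R) Lspace_dot dot_bilinear.

Let dot_hermitian (x y : L) :
  Lspace_dot x y = (-1) ^+ false * idfun (Lspace_dot y x).
Proof. rewrite expr0 mul1r; exact: dotC. Qed.

HB.instance Definition _ :=
  isHermitianSesquilinear.Build R L false idfun Lspace_dot dot_hermitian.

Let dotxx (x : L) : Lspace_dot x x = `|x| ^+ 2.
Proof. by rewrite /Lspace_dot Lspace_pairxx// powR_mulrn. Qed.

Let dot_gt0 (x : L) : x != 0 -> 0 < Lspace_dot x x.
Proof. by move=> x0; rewrite dotxx exprn_gt0// normr_gt0. Qed.

HB.instance Definition _ := isDotProduct.Build R L Lspace_dot dot_gt0.

Lemma is_hilbert_Lspace2 : is_hilbert L.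
Proof. by exists Lspace_dot => x; rewrite -dotxx. Qed.

End hilbert_Lspace2.

(** * Multiplication by a weight as an operator from L_p to L_2 *)

Section weighted_embedding.
Context {d : measure_display} {T : measurableType d} {R : realType}.
Variables (mu : {measure set T -> \bar R}) (p : R) (p1 : (1 <= p%:E)%E).
Variable q1 : (1 <= (2 : R)%:E)%E.
Local Notation L := (LspaceType mu p1).
Local Notation H := (LspaceType mu q1).

(* [S x = x * |y| `^ ((p - 2) / 2)]: its square is integrable since
   [|x| `^ 2 * |y| `^ (p - 2) <= |x| `^ p + |y| `^ p]. *)
Lemma weighted_embedding (y : L) : 2 < p ->
  exists S : L -> H, [/\ linear S, bounded_on setT S
    & forall x, S x = 0 -> ae_disjoint x y].
Proof.
move=> p2; have p0 : 0 < p by exact: lt_trans p2.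
pose w t := `|y t| `^ ((p - 2) / 2).
have mw : measurable_fun setT w.
  exact/measurable_normr_powR/measurable_Lspace.
have mxw (x : L) : measurable_fun setT (fun t => x t * w t).
  by apply: measurable_funM => //; exact: measurable_Lspace.
have w2 (x : L) t : `|x t * w t| `^ 2 <= `|x t| `^ p + `|y t| `^ p.
  rewrite /w normrM powRM// (ger0_norm (powR_ge0 _ _)) -powRrM divfK//.
  have := @mul_powR_le _ 2 (p - 2) (x t) (y t).
  by rewrite subrKC; apply => //; rewrite subr_ge0 ltW.
have iw (x : L) :
    (\int[mu]_t (`|x t * w t| `^ 2)%:E <= (`|x| `^ p + `|y| `^ p)%:E)%E.
  have m (z : L) := emeasurable_normr_powR p (measurable_Lspace z).
  rewrite EFinD -!integral_Lspace -ge0_integralD//.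
  apply: ge0_le_integral => //.
  - exact: emeasurable_normr_powR.
  - exact: emeasurable_funD.
  - by move=> t _; rewrite -EFinD lee_fin.
have /choice[S SE] : forall x : L, exists z : H,
    \forall t \ae mu, z t = x t * w t.
  by move=> x; apply: Lspace_of_fun => //; apply: le_lt_trans (iw x) (ltry _).
have Slin : linear S.
  move=> a x x'; apply/LspaceP; near=> t.
  rewrite (near (SE (a *: x + x')) t)// (near (LspaceD (a *: x) x') t)//.
  rewrite (near (LspaceZ a x) t)// (near (LspaceD (a *: S x) (S x')) t)//.
  rewrite (near (LspaceZ a (S x)) t)// (near (SE x) t)// (near (SE x') t)//.
  by rewrite mulrDl mulrA.
have Sx0 x : S x = 0 -> ae_disjoint x y.
  move=> Sx; near=> t; have : S x t = x t * w t by near: t.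
  rewrite Sx (near (Lspace0 mu q1) t)// => /esym/eqP; rewrite mulf_eq0.
  case/orP => [/eqP ->|/eqP/powR_eq0_eq0/eqP]; first by rewrite mul0r.
  by rewrite normr_eq0 => /eqP ->; rewrite mulr0.
exists S; split => //.
exists (Num.sqrt (1 + `|y| `^ p)) => x _.
(* The integral bound [iw] is not homogeneous in [x], so it is used on the unit sphere only and
   extended by scaling. *)
have Sunit u : `|u| = 1 -> `|S u| <= Num.sqrt (1 + `|y| `^ p).
  move=> u1; rewrite -[leLHS]ger0_norm// -sqrtr_sqr ler_sqrt; last first.
    by rewrite addr_ge0// powR_ge0.
  rewrite -powR_mulrn// -lee_fin -(Lspace_norm_ae (mxw u) (SE u)).
  by have := iw u; rewrite u1 powR1.
have S0 : S 0 = 0.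
  by have := Slin (-1) 0 0; rewrite scaler0 addr0 scaleN1r addNr.
have [->|x0] := eqVneq x 0; first by rewrite S0 !normr0 mulr0.
have nx : 0 < `|x| by rewrite normr_gt0.
have /Sunit : `| `|x|^-1 *: x| = 1.
  by rewrite normrZ normfV normr_id mulVf// gt_eqF.
rewrite -[_ *: x]addr0 Slin S0 addr0 normrZ normfV normr_id.
by rewrite ler_pdivrMl// mulrC.
Unshelve. all: by end_near.
Qed.

End weighted_embedding.

(** * Maximal disjoint families, and the implication from (d) to (a) *)

Section maximal_disjoint_families.
Context {d : measure_display} {T : measurableType d} {R : realType}.
Variables (mu : {measure set T -> \bar R}) (p : R) (p1 : (1 <= p%:E)%E).
Local Notation L := (LspaceType mu p1).

Lemma submod_setP (X : set L) a (x y : L) :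
  submod_closed (mem X) -> X x -> X y -> X (a *: x + y).
Proof.
move=> [_ Xlin] Xx Xy.
exact: set_mem (Xlin _ _ _ (mem_set Xx) (mem_set Xy)).
Qed.

(* [Gamma] is the graph of a partial function on [G]. *)
Definition disjoint_graph (X : set L) (G : Type) (Gamma : set (G * L)) :=
  (forall g v, Gamma (g, v) -> X v /\ `|v| = 1) /\
  (forall g v g' v', Gamma (g, v) -> Gamma (g', v') ->
    (g = g' -> v = v') /\ (g <> g' -> ae_disjoint v v')).

(** Zorn's lemma applies because the conditions involve at most two pairs at a time, and two pairs
    in the union of a chain lie in one member. *)
Lemma exists_maximal_disjoint_graph (X : set L) (G : Type) :
  exists Gamma : set (G * L), disjoint_graph X Gamma /\
    forall Gamma', Gamma `<` Gamma' -> ~ disjoint_graph X Gamma'.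
Proof.
apply: Zorn_bigcup => F FP Ftot; split=> [g v [A FA Agv]|].
  exact: (FP _ FA).1 Agv.
move=> g v g' v' [A FA Agv] [A' FA' Agv'].
have [AA'|A'A] := Ftot _ _ FA FA'.
  exact: (FP _ FA').2 (AA' _ Agv) Agv'.
exact: (FP _ FA).2 Agv (A'A _ Agv').
Qed.

(** A nonzero [x], once normalized, could be added at the free index [g0], against maximality. *)
Lemma maximal_disjoint_graph_full (X : set L) (G : Type) (Gamma : set (G * L))
    g0 (x : L) : closed_subspace X -> disjoint_graph X Gamma ->
  (forall Gamma', Gamma `<` Gamma' -> ~ disjoint_graph X Gamma') ->
  (forall v, ~ Gamma (g0, v)) -> X x ->
  (forall g v, Gamma (g, v) -> ae_disjoint x v) -> x = 0.
Proof.
move=> [_ Xsub] [G1 G2] Gmax g0G Xx xd; apply/eqP; apply: contraT => x0.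
pose u := `|x|^-1 *: x.
have ud g v : Gamma (g, v) -> ae_disjoint u v.
  by move=> /xd; exact: ae_disjointZ.
exfalso; apply: (Gmax (Gamma `|` [set (g0, u)])).
  split; first by move=> ?; left.
  by move=> /(_ (g0, u)) h; apply: (g0G u); apply: h; right.
split=> [g v [/G1//|[_ ->]]|g v g' v'].
  split; last by rewrite normrZ normfV normr_id mulVf// normr_eq0.
  rewrite /u -[_ *: _]addr0; apply: submod_setP => //.
  by case: Xsub => /set_mem.
move=> [Gv|[-> ->]] [Gv'|[-> ->]].
- exact: G2 Gv Gv'.
- split=> [gg0|_]; first by rewrite gg0 in Gv; case: (g0G _ Gv).
  exact: ae_disjointC (ud _ _ Gv).
- split=> [gg0|_]; first by rewrite -gg0 in Gv'; case: (g0G _ Gv').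
  exact: ud Gv'.
- by [].
Qed.

(** Take for [y] the sum of the series of z n / 2^n. On the support of [z n] all other terms vanish,
    so [y] agrees there with z n / 2^n and is nonzero. *)
Lemma disjoint_sequence_support (z : nat -> L) :
  (forall n, `|z n| <= 1) -> (forall m n, m <> n -> ae_disjoint (z m) (z n)) ->
  exists y : L, forall x, ae_disjoint x y -> forall n, ae_disjoint x (z n).
Proof.
move=> z1 zd; pose u n : L := \sum_(0 <= i < n) 2^-1 ^+ i *: z i.
have half0 i : 0 <= 2^-1 ^+ i :> R by rewrite exprn_ge0// invr_ge0.
have uS n : `|u n.+1 - u n| <= 1 * 2^-1 ^+ n.
  rewrite /u big_nat_recr//= addrAC subrr add0r normrZ ger0_norm// mul1r.
  by rewrite ler_piMr.
have ud := geometric_dist (ler0n _ 1) uS.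
have : cauchy (u @ \oo) by apply: geometric_cvg ud; rewrite mulr_ge0.
move=> /cauchy_cvg/cvg_ex[/= y uy]; exists y => x xy n.
have yz : ae_disjoint (y - 2^-1 ^+ n *: z n) (z n).
  apply: ae_disjoint_approx => e e0.
  have /cvgrPdist_le /(_ _ e0) hy := uy.
  (* With N > n the n-th term occurs in [u N]; removing it leaves a sum disjoint from [z n]. *)
  have [N [/= h nN]] := filter_ex (filterI hy (nbhs_infty_gt n)).
  exists (u N - 2^-1 ^+ n *: z n); last by rewrite opprB addrA subrK.
  rewrite /u (bigD1_seq n) ?mem_index_iota ?iota_uniq//= addrAC subrr add0r.
  by apply: ae_disjoint_sum => i /eqP ni; apply/ae_disjointZ/zd.
near=> t.
have /eqP : x t * y t = 0 by near: t.
rewrite mulf_eq0 => /orP[/eqP ->|/eqP yt]; first by rewrite mul0r.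
have : (y - 2^-1 ^+ n *: z n) t * z n t = 0 by near: t.
rewrite (near (LspaceB y (2^-1 ^+ n *: z n)) t)// (near (LspaceZ _ (z n)) t)//.
rewrite yt sub0r => /eqP; rewrite mulNr oppr_eq0 -mulrA mulf_eq0.
rewrite expf_eq0 invr_eq0 pnatr_eq0 andbF/= mulf_eq0 orbb => /eqP ->.
by rewrite mulr0.
Unshelve. all: by end_near. Qed.

Lemma isometric_copy_or_full_element (X : set L) (G : pointedType) :
  closed_subspace X -> card_aleph1 G ->
  embeds_isometrically (ell R G p1) X \/
  exists y : L, forall x, X x -> ae_disjoint x y -> x = 0.
Proof.
move=> cX [Gunc Gmin]; have [_ Xsub] := cX.
have X0 : X 0 by case: Xsub => /set_mem.
have [Gamma [[G1 G2] Gmax]] := exists_maximal_disjoint_graph X G.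
pose A := [set g | exists v, Gamma (g, v)].
have [Ac|AG] := Gmin A; [right|left]; last first.
  move: AG; rewrite card_eq_sym card_eq_le => /andP[/pcard_leP[h] _].
  have /choice[v hv] : forall g, exists v, Gamma (h g, v).
    by move=> g; have := @funS _ _ _ _ h g I.
  apply: (ell_isometry (v := v)) => // [g|]; first by case: (G1 _ _ (hv g)).
  split=> [g|g g' gg']; first by case: (G1 _ _ (hv g)).
  apply: (G2 _ _ _ _ (hv g) (hv g')).2 => hgg'; apply: gg'.
  by apply: (@inj _ _ _ h _ _ _ _ hgg'); exact: mem_set.
(* [A] is countable and [G] is not, so there is room to enlarge the family. *)
have [g0 g0A] : exists g0, ~ A g0.
  apply: contrapT => nA; apply: Gunc; apply: sub_countable Ac.
  apply: subset_card_le => g _; apply: contrapT => Ag; apply: nA.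
  by exists g.
have /countable_injP[f finj] := Ac.
pose Z n := [set v | exists2 g, Gamma (g, v) & f g = n].
(* Numbers that are not codes [f g] get the default 0, which is disjoint from everything; hence the
   norms are bounded by 1 rather than equal to it. *)
pose z n := xget 0 (Z n).
have zP n : Z n (z n) \/ z n = 0.
  have [Zn|Zn] := pselect (exists v, Z n v).
    by left; exact: xgetPex.
  by right; apply: xgetPN => v Znv; apply: Zn; exists v.
have zG g v : Gamma (g, v) -> z (f g) = v.
  move=> Ggv; have [g' Gg' fg'] : Z (f g) (z (f g)).
    by apply: xgetPex; exists v, g.
  apply: (G2 _ _ _ _ Gg' Ggv).1.
  by apply: finj => //; apply: mem_set; eexists; eassumption.
have [||y yP] := @disjoint_sequence_support z.
- move=> n; have [[g /G1[_ ->]//]|->] := zP n.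
  by rewrite normr0.
- move=> m n mn; have [[g Gg fg]|->] := zP m; last exact: ae_disjoint0.
  have [[g' Gg' fg']|->] := zP n; last exact/ae_disjointC/ae_disjoint0.
  by apply: (G2 _ _ _ _ Gg Gg').2 => gg'; apply: mn; rewrite -fg -fg' gg'.
exists y => x Xx xy.
apply: (maximal_disjoint_graph_full (g0 := g0) cX (conj G1 G2) Gmax _ Xx).
  by move=> v Gv; apply: g0A; exists v.
by move=> g v /zG <-; exact: yP.
Qed.

Lemma injects_in_hilbert_full (X : set L) (y : L) : 2 < p ->
  closed_subspace X -> (forall x, X x -> ae_disjoint x y -> x = 0) ->
  injects_in_hilbert X.
Proof.
move=> p2 [_ Xsub] yfull.
have q1 : (1 <= (2 : R)%:E)%E by rewrite lee_fin ler1n.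
have [S [Slin [K SK] S0]] := weighted_embedding q1 y p2.
exists (LspaceType mu q1); split; first exact: is_hilbert_Lspace2.
exists S; split=> [a x x' _ _||x x' /set_mem Xx /set_mem Xx' Sxx'].
- exact: Slin.
- by exists K => x _; exact: SK.
- apply/eqP; rewrite -subr_eq0; apply/eqP/yfull.
    by rewrite addrC -scaleN1r; exact: submod_setP.
  by apply: S0; rewrite addrC -scaleN1r Slin Sxx' scaleN1r addNr.
Qed.

End maximal_disjoint_families.

Theorem proposition1 (R : realType) (p : R) (p2 : 2 < p)
    (d : measure_display) (T : measurableType d)
    (nu : {measure set T -> \bar R})
    (X : set (LspaceType nu (gt2_ge1e p2))) (hX : closed_subspace X)
    (G : pointedType) (hG : card_aleph1 G) :
  [<-> (* (a) *) embeds_isometrically (ell R G (gt2_ge1e p2)) X;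
       (* (b) *) exists Y : set (LspaceType nu (gt2_ge1e p2)),
         [/\ closed_subspace Y, Y `<=` X,
             isomorphic_to (ell R G (gt2_ge1e p2)) Y & complemented Y];
       (* (c) *) embeds_isomorphically (ell R G (gt2_ge1e p2)) X;
       (* (d) *) ~ injects_in_hilbert X].
Proof.
tfae.
- exact: isometric_copy_complemented.
- by move=> [Y [cY YX isoY _]]; exists Y.
- exact: not_injects_in_hilbert p2 hG.1.
- move=> nH; have [//|[y yfull]] := isometric_copy_or_full_element hX hG.
  by case: nH; exact: injects_in_hilbert_full p2 hX yfull.
Qed.
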